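(* Consider an arbitrary Markov chain on a general phase space $(X,\Sigma)$. Suppose that the space $M_{ba}$ of its invariant finitely additive measures is finite-dimensional, $\dim M_{ba}=\dim\Delta_{ba}=n<\infty$, and that the following conditions hold: $(\alpha)$: for every $\mu\in\Delta_{ba}$ and every $K_\mu\in\Sigma$ with $\mu(K_\mu)=1$ there exists a set $K\subset K_\mu$, $K\in\Sigma$, such that $\mu(K)=1$ and $K$ is stochastically closed, i.e. $p(x,K)=1$ for every $x\in K$; $(\beta)$: the measures of the disjoint basis $H_{ba}$ of $M_{ba}$ are pairwise singular. Then $\Delta_{ba}\subset ca(X,\Sigma)$ (condition $( * )$), i.e. all invariant finitely additive measures of the chain are countably additive; the following conditions $(D)$ and $(\tilde D)$, equivalent to $( * )$, hold; and the chain is quasicompact, i.e. condition $(K)$ holds: $(D)$: there exist a bounded measure $\varphi\in ca(X,\Sigma)$, $\varphi\ge 0$, $\varepsilon>0$ and an integer $k\ge 1$ such that for every $E\in\Sigma$, $\varphi(E)\le\varepsilon$ implies $p^k(x,E)\le 1-\varepsilon$ for all $x\in X$; $(\tilde D)$: there exist a bounded measure $\varphi\in ca(X,\Sigma)$, $\varphi\ge 0$, $\varepsilon>0$ and an integer $m\ge 1$ such that for every $E\in\Sigma$, $\varphi(E)<\varepsilon$ implies $\frac1m\sum_{k=1}^m p^k(x,E)\le 1-\varepsilon$ for all $x\in X$; $(K)$: there exist a compact operator $A_1:ca(X,\Sigma)\to ca(X,\Sigma)$ and an integer $k\ge 1$ such that $\|A^k-A_1\|<1$, where $A$ is considered on 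$ca(X,\Sigma)$.
   Context: $X$ is an arbitrary infinite set and $\Sigma$ is a $\sigma$-algebra of subsets of $X$ containing all singletons. $B(X,\Sigma)$ is the Banach space of bounded $\Sigma$-measurable functions $f:X\to\mathbb{R}$ with the sup-norm. $ba(X,\Sigma)$ is the Banach space of bounded finitely additive measures $\mu:\Sigma\to\mathbb{R}$ with the total variation norm, ordered setwise (it is a vector lattice), and $ca(X,\Sigma)$ is its subspace of countably additive measures. $S_{ba}=\{\mu\in ba(X,\Sigma):\mu\ge 0,\ \|\mu\|=1\}$. A Markov chain is given by a transition function $p(x,E)$, $x\in X$, $E\in\Sigma$, with $0\le p(x,E)\le 1$, $p(x,X)=1$, $p(\cdot,E)\in B(X,\Sigma)$ for all $E\in\Sigma$, and $p(x,\cdot)\in ca(X,\Sigma)$ for all $x\in X$. Its iterates are $p^1=p$, $p^{k+1}(x,E)=\int_X p^k(y,E)\,p(x,dy)$. The Markov operator $A:ba(X,\Sigma)\to ba(X,\Sigma)$ is $A\mu(E)=\int_X p(x,E)\,\mu(dx)$; it maps $ca(X,\Sigma)$ into itself. $\Delta_{ba}=\{\mu\in S_{ba}: A\mu=\mu\}$; $M_{ba}=\{\mu\in ba(X,\Sigma):A\mu=\mu\}$ is the linear span of $\Delta_{ba}$, and $\dim\Delta_{ba}:=\dim M_{ba}$. Two nonnegative measures $\mu_1,\mu_2\in ba(X,\Sigma)$ are disjoint if $\mu_1\wedge\mu_2=0$, and singular if there are disjoint sets $D_1,D_2\in\Sigma$ with $\mu_1(D_1)=\mu_1(X)$ and $\mu_2(D_2)=\mu_2(X)$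 (singularity implies disjointness but not conversely for finitely additive measures). When $M_{ba}$ is finite-dimensional, of dimension $n$, it has a linear basis $H_{ba}=\{\mu_1,\dots,\mu_n\}\subset\Delta_{ba}$ consisting of pairwise disjoint measures; this is called the disjoint basis of $M_{ba}$. *)

(* Defs.v *)
From HB Require Import structures.
From mathcomp Require Import all_boot all_order all_algebra.
From mathcomp Require Import finmap.
From mathcomp Require Import all_classical all_reals all_analysis.

From mathcomp Require Import measurable_realfun ring lra zify.

Set Implicit Arguments.
Unset Strict Implicit.
Unset Printing Implicit Defensive.
Import Order.TTheory GRing.Theory Num.Theory.
Import numFieldNormedType.Exports.
Local Open Scope classical_set_scope.
Local Open Scope ring_scope.

Section ba_type.
Context {d : measure_display} (X : measurableType d) (R : realType).

(* A finitely additive measure lives on the sigma-algebra only; it is encoded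
   as a function on all subsets of X, with the value 0 at the non-measurable
   ones, so that equality in ba is equality on measurable sets. *)
Definition is_ba : set (set X -> R) := [set mu : set X -> R |
  [/\ additive2 (EFin \o mu),
      exists M : R, forall E, measurable E -> `|mu E| <= M
    & forall E, ~ measurable E -> mu E = 0]].

Definition ba_pred : {pred set X -> R} := mem is_ba.

Record ba : Type := Ba { ba_fun :> set X -> R ; ba_funP : ba_fun \in ba_pred }.

HB.instance Definition _ := [isSub for ba_fun].
HB.instance Definition _ := [Choice of ba by <:].

Fact ba_submod_closed : submod_closed ba_pred.
Proof.
split.
  rewrite inE; split => //=.
  - by move=> A B _ _ _ /=; rewrite adde0.
  - by exists 0 => E _; rewrite normr0.
move=> a f g; rewrite !inE => -[fD [Mf fM] f0] [gD [Mg gM] g0]; split.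
- move=> A B mA mB AB.
  have /= [fAB] := fD A B mA mB AB; have /= [gAB] := gD A B mA mB AB.
  by rewrite /= -EFinD; congr EFin; rewrite !fctE fAB gAB scalerDr addrACA.
- exists (`|a| * Mf + Mg) => E mE; apply: (le_trans (ler_normD _ _)).
  by rewrite lerD ?gM// normrM ler_wpM2l ?fM.
- by move=> E mE; rewrite !fctE f0// g0// addr0 scaler0.
Qed.
HB.instance Definition _ :=
  GRing.isSubmodClosed.Build R (set X -> R) ba_pred ba_submod_closed.
HB.instance Definition _ := [SubChoice_isSubLmodule of ba by <:].

End ba_type.

Section ba_norm.
Context {d : measure_display} {X : measurableType d} {R : realType}.
Implicit Types mu nu : ba X R.

Lemma ba_add mu (A B : set X) : measurable A -> measurable B ->
  A `&` B = set0 -> mu (A `|` B) = mu A + mu B.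
Proof.
by move=> mA mB AB; have := ba_funP mu; rewrite inE => -[/(_ A B mA mB AB)[]].
Qed.

Lemma ba_bounded mu : exists2 M : R, 0 <= M & forall E, `|mu E| <= M.
Proof.
have := ba_funP mu; rewrite inE => -[_ [M muM] mu0].
have M0 : 0 <= M by rewrite (le_trans _ (muM set0 _)).
exists M => // E; have [mE|/mu0 ->] := pselect (measurable E); first exact: muM.
by rewrite normr0.
Qed.

Lemma ba_nonmeasurable mu E : ~ measurable E -> mu E = 0.
Proof. by have := ba_funP mu; rewrite inE => -[_ _]; apply. Qed.

Lemma ba_set0 mu : mu set0 = 0.
Proof.
have := ba_add mu (@measurable0 _ X) (@measurable0 _ X) (setI0 _).
by rewrite setU0 => /eqP; rewrite -subr_eq subrr eq_sym => /eqP.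
Qed.

Lemma ba_ext mu nu : (forall E, measurable E -> mu E = nu E) -> mu = nu.
Proof.
move=> munu; apply/val_inj/funext => E /=.
have [/munu//|nE] := pselect (measurable E).
by rewrite !ba_nonmeasurable.
Qed.

Lemma ba_addE mu nu E : (mu + nu) E = mu E + nu E. Proof. by []. Qed.
Lemma ba_scaleE a mu E : (a *: mu) E = a * mu E. Proof. by []. Qed.
Lemma ba_0E E : (0 : ba X R) E = 0. Proof. by []. Qed.

Lemma ba_big mu (I : eqType) (r : seq I) (F : I -> set X) : uniq r ->
  (forall i, measurable (F i)) ->
  (forall i j, i \in r -> j \in r -> i != j -> F i `&` F j = set0) ->
  mu (\big[setU/set0]_(i <- r) F i) = \sum_(i <- r) mu (F i).
Proof.
elim: r => [|i r IH] /=; first by rewrite !big_nil ba_set0.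
move=> /andP[ir ur] mF Fdis; rewrite !big_cons ba_add//.
- congr (_ + _); apply: IH => // j k jr kr.
  by apply: Fdis; rewrite inE ?jr ?kr orbT.
- exact: bigsetU_measurable.
- rewrite big_distrr /= big1_seq// => j /andP[_ jr].
  apply: Fdis; rewrite ?inE ?eqxx ?jr ?orbT//.
  by apply: contraNneq ir => ->.
Qed.

(* The disjoint sets need not cover X: adding the complement of their union
   only increases the sum. *)
Definition tv_sums mu : set R := [set r |
  exists n (E : nat -> set X),
    [/\ forall i, measurable (E i), trivIset `I_n E
      & r = \sum_(i < n) `|mu (E i)|]].

Definition tv mu : R := sup (tv_sums mu).

Lemma tv_sums_neq0 mu : tv_sums mu !=set0.
Proof.
exists 0, 0%N, (fun=> set0); by split => //; rewrite big_ord0.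
Qed.

Lemma tv_sums_bounded mu : has_ubound (tv_sums mu).
Proof.
have [M M0 muM] := ba_bounded mu.
exists (M + M) => _ [n [E [mE /trivIsetP tE ->]]].
rewrite -(big_mkord xpredT (fun i => `|mu (E i)|)).
have key (P : pred nat) :
    `|\sum_(0 <= i < n | P i) mu (E i)| <= M.
  rewrite -big_filter -ba_big ?filter_uniq ?iota_uniq// => i j.
  rewrite !mem_filter !mem_index_iota => /andP[_ /andP[_ ilt]].
  by move=> /andP[_ /andP[_ jlt]] ij; exact: tE.
rewrite (bigID (fun i => 0 <= mu (E i))) /=; apply: lerD.
  apply: le_trans (key (fun i => 0 <= mu (E i))).
  by rewrite (eq_bigr (fun i => mu (E i))) ?ler_norm// => i /ger0_norm.
apply: le_trans (key (fun i => ~~ (0 <= mu (E i)))).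
rewrite (eq_bigr (fun i => - mu (E i))).
  by rewrite sumrN -normrN ler_norm.
by move=> i; rewrite -ltNge => /ltr0_norm.
Qed.

Lemma tv_sums_le mu r : tv_sums mu r -> r <= tv mu.
Proof. exact/ub_le_sup/tv_sums_bounded. Qed.

Lemma tv_le mu M : (forall r, tv_sums mu r -> r <= M) -> tv mu <= M.
Proof. by move=> h; apply: ge_sup => //; exact: tv_sums_neq0. Qed.

Lemma tv_ge0 mu : 0 <= tv mu.
Proof.
apply: tv_sums_le; exists 0%N, (fun=> set0).
by split => //; rewrite big_ord0.
Qed.

Lemma ba_le_tv mu E : `|mu E| <= tv mu.
Proof.
have [mE|nE] := pselect (measurable E); last first.
  by rewrite ba_nonmeasurable// normr0 tv_ge0.
apply: tv_sums_le; exists 1%N, (fun=> E); split => //.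
- by apply/trivIsetP => -[|i] [|j].
- by rewrite big_ord1.
Qed.

Fact tv_triangle mu nu : tv (mu + nu) <= tv mu + tv nu.
Proof.
apply: tv_le => _ [n [E [mE tE ->]]].
apply: (@le_trans _ _ (\sum_(i < n) `|mu (E i)| + \sum_(i < n) `|nu (E i)|)).
  by rewrite -big_split; apply: ler_sum => i _; exact: ler_normD.
by apply: lerD; apply: tv_sums_le; exists n, E.
Qed.

Fact tv_scale a mu : tv (a *: mu) = `|a| * tv mu.
Proof.
have le b nu : tv (b *: nu) <= `|b| * tv nu.
  apply: tv_le => _ [n [E [mE tE ->]]].
  rewrite (eq_bigr (fun i : 'I_n => `|b| * `|nu (E i)|)).
    by rewrite -mulr_sumr ler_wpM2l// tv_sums_le//; exists n, E.
  by move=> i _; rewrite ba_scaleE normrM.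
apply/eqP; rewrite eq_le le /=; have [->|a0] := eqVneq a 0.
  by rewrite normr0 mul0r tv_ge0.
rewrite mulrC -ler_pdivlMr ?normr_gt0// mulrC -normfV.
by rewrite (le_trans _ (le a^-1 (a *: mu)))// scalerA mulVf// scale1r.
Qed.

Fact tv_eq0 mu : tv mu = 0 -> mu = 0.
Proof.
move=> mu0; apply: ba_ext => E _; rewrite ba_0E; apply/eqP.
by rewrite -normr_le0 -mu0 ba_le_tv.
Qed.

HB.instance Definition _ :=
  Lmodule_isNormed.Build R (ba X R) tv_triangle tv_scale tv_eq0.

Definition ba_le mu nu := `[< forall E, measurable E -> mu E <= nu E >].
Definition ba_lt mu nu := (nu != mu) && ba_le mu nu.

Fact ba_lt_def mu nu : ba_lt mu nu = (nu != mu) && ba_le mu nu.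
Proof. by []. Qed.

Fact ba_le_refl : reflexive ba_le.
Proof. by move=> mu; apply/asboolP. Qed.

Fact ba_le_anti : antisymmetric ba_le.
Proof.
move=> mu nu /andP[/asboolP h1 /asboolP h2]; apply: ba_ext => E mE.
by apply/eqP; rewrite eq_le h1// h2.
Qed.

Fact ba_le_trans : transitive ba_le.
Proof.
move=> nu mu la /asboolP h1 /asboolP h2; apply/asboolP => E mE.
exact: le_trans (h1 E mE) (h2 E mE).
Qed.

HB.instance Definition _ := Order.isPOrder.Build ring_display (ba X R)
  ba_lt_def ba_le_refl ba_le_anti ba_le_trans.

Lemma ba_leP mu nu :
  reflect (forall E, measurable E -> mu E <= nu E) (mu <= nu).
Proof. exact: asboolP. Qed.

Lemma ba_normE mu : `|mu| = sup (tv_sums mu). Proof. by []. Qed.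

End ba_norm.

Section ca_type.
Context {d : measure_display} (X : measurableType d) (R : realType).

Definition is_ca : set (ba X R) :=
  [set mu : ba X R | semi_sigma_additive (EFin \o mu)].

Lemma is_caP (mu : ba X R) : is_ca mu <->
  forall F : nat -> set X, (forall i, measurable (F i)) -> trivIset setT F ->
    (fun n => \sum_(0 <= i < n) mu (F i)) @ \oo --> mu (\bigcup_n F n).
Proof.
have EFin_sum (F : nat -> set X) :
    (fun n => \sum_(0 <= i < n) (EFin \o mu) (F i))%E =
    EFin \o (fun n => \sum_(0 <= i < n) mu (F i)).
  by apply/funext => n /=; rewrite sumEFin.
split => [ca F mF tF|ca F mF tF mUF].
  have := ca F mF tF (bigcup_measurable (fun k _ => mF k)).
  by rewrite EFin_sum => /fine_cvgP[].
by rewrite EFin_sum; apply/fine_cvgP; split; [exact: nearW|exact: ca].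
Qed.

Definition ca_pred : {pred ba X R} := mem is_ca.

Record ca : Type := Ca { ca_ba :> ba X R ; ca_baP : ca_ba \in ca_pred }.

HB.instance Definition _ := [isSub for ca_ba].
HB.instance Definition _ := [Choice of ca by <:].

Fact ca_submod_closed : submod_closed ca_pred.
Proof.
split.
  rewrite inE; apply/is_caP => F _ _ /=.
  rewrite (_ : (fun _ => _) = fun=> 0); first exact: cvg_cst.
  by apply/funext => n; rewrite big1.
move=> a f g; rewrite !inE => /is_caP fca /is_caP gca; apply/is_caP => F mF tF.
rewrite (_ : (fun _ => _) = (fun n => a *: (\sum_(0 <= i < n) f (F i)) +
    \sum_(0 <= i < n) g (F i))).
  by apply: cvgD; [apply: cvgZr; exact: fca|exact: gca].
by apply/funext => n; rewrite scaler_sumr -big_split.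
Qed.
HB.instance Definition _ :=
  GRing.isSubmodClosed.Build R (ba X R) ca_pred ca_submod_closed.
HB.instance Definition _ := [SubChoice_isSubLmodule of ca by <:].

Definition ca_norm (mu : ca) : R := `|ca_ba mu|.

Fact ca_norm_triangle mu nu : ca_norm (mu + nu) <= ca_norm mu + ca_norm nu.
Proof. exact: ler_normD. Qed.

Fact ca_norm_scale a mu : ca_norm (a *: mu) = `|a| * ca_norm mu.
Proof. exact: normrZ. Qed.

Fact ca_norm_eq0 mu : ca_norm mu = 0 -> mu = 0.
Proof. by move=> /normr0_eq0 mu0; exact/val_inj. Qed.

HB.instance Definition _ :=
  Lmodule_isNormed.Build R ca ca_norm_triangle ca_norm_scale ca_norm_eq0.

End ca_type.

Section ba_integral.
Import HBSimple.
Context {d : measure_display} {X : measurableType d} {R : realType}.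
Implicit Types (mu : ba X R) (f g : X -> R) (s t : {sfun X >-> R}).

(* The integral of a bounded measurable function is the limit of the integrals
   of simple functions converging to it uniformly. *)
Definition is_ba_int mu f (I : R) := exists s : nat -> {sfun X >-> R},
  (forall e, 0 < e -> \forall n \near \oo, forall x, `|f x - s n x| <= e) /\
  sintegral (EFin \o mu) (s n) @[n --> \oo] --> I%:E.

Definition ba_int mu f : R := xget 0 [set I | is_ba_int mu f I].

Let sint mu f : R :=
  \sum_(c <- fset_set (range f)) c * mu (f @^-1` [set c]).

Let sintegral_sint mu s : sintegral (EFin \o mu) s = (sint mu s)%:E.
Proof.
rewrite /sintegral -(fsbig_widen (range s) setT) //=; last first.
  by move=> x [_ /= /preimage10 ->]; rewrite ba_set0 mule0.
rewrite fsbig_finite//= /sint -sumEFin.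
by apply: eq_bigr => c _; rewrite EFinM.
Qed.

Let sint_comp mu (I : choiceType) (h : X -> I) (g : I -> R) :
  finite_set (range h) -> (forall i, measurable (h @^-1` [set i])) ->
  sint mu (g \o h) =
  \sum_(i <- fset_set (range h)) g i * mu (h @^-1` [set i]).
Proof.
move=> finh mh; rewrite /sint.
have fingh : finite_set (range (g \o h)).
  rewrite (_ : range _ = g @` range h); first exact: finite_image finh.
  by rewrite image_comp.
have fib c : (g \o h) @^-1` [set c] =
    \big[setU/set0]_(i <- [seq i <- fset_set (range h) | g i == c])
      h @^-1` [set i].
  rewrite -bigcup_seq; apply/seteqP; split=> x /=.
    move=> ghx; exists (h x) => //=.
    by rewrite mem_filter ghx eqxx/= in_fset_set// inE; exists x.
  by move=> [i /=]; rewrite mem_filter => /andP[/eqP <- _] ->.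
rewrite (eq_bigr (fun c => \sum_(i <- fset_set (range h) | g i == c)
    g i * mu (h @^-1` [set i]))); last first.
  move=> c _; rewrite fib ba_big ?filter_uniq ?fset_uniq//.
    rewrite big_filter mulr_sumr; apply: eq_bigr => i /eqP <-//.
  move=> i j _ _ ij; apply/seteqP; split => // x [/= hi hj].
  by move: ij; rewrite -hi hj eqxx.
rewrite (exchange_big_dep xpredT)//= big_seq [RHS]big_seq.
apply: eq_bigr => i; rewrite in_fset_set// inE => -[x _ <-].
rewrite -big_filter (_ : [seq _ <- _ | _] = [:: g (h x)]) ?big_seq1//.
rewrite (eq_filter (a2 := pred1 (g (h x)))); last first.
  by move=> c /=; rewrite eq_sym.
apply: filter_pred1_uniq; first exact: fset_uniq.
by rewrite in_fset_set// inE; exists x.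
Qed.

Let sint2 mu s t (g : R * R -> R) :
  sint mu (fun x => g (s x, t x)) =
  \sum_(i <- fset_set (range (fun x => (s x, t x))))
    g i * mu ((fun x => (s x, t x)) @^-1` [set i]).
Proof.
rewrite -(@sint_comp mu _ (fun x => (s x, t x)))//.
  apply: (@sub_finite_set _ _ (range s `*` range t)); last first.
    by apply: finite_setX; exact: fimfunP.
  by move=> _ [x _ <-] /=; split; exists x.
move=> [a b]; rewrite (_ : _ @^-1` _ = s @^-1` [set a] `&` t @^-1` [set b]).
  by apply: measurableI; exact: measurable_funPTI.
by apply/seteqP; split => x /= [-> ->].
Qed.

Let sintD mu s t : sint mu (fun x => s x + t x) = sint mu s + sint mu t.
Proof.
rewrite (sint2 mu s t (fun z => z.1 + z.2)).
rewrite (sint2 mu s t fst) (sint2 mu s t snd) -big_split.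
by apply: eq_bigr => i _; rewrite mulrDl.
Qed.

Let sintB mu s t : sint mu (fun x => s x - t x) = sint mu s - sint mu t.
Proof.
rewrite (sint2 mu s t (fun z => z.1 - z.2)).
rewrite (sint2 mu s t fst) (sint2 mu s t snd) -sumrB.
by apply: eq_bigr => i _; rewrite mulrBl.
Qed.

Let sint_bound mu s M : 0 <= M -> (forall x, `|s x| <= M) ->
  `|sint mu s| <= M * `|mu|.
Proof.
move=> M0 sM; apply: (le_trans (ler_norm_sum _ _ _)).
apply: (@le_trans _ _ (\sum_(c <- fset_set (range s))
    M * `|mu (s @^-1` [set c])|)).
  rewrite big_seq [leRHS]big_seq; apply: ler_sum => c.
  rewrite in_fset_set; last exact: fimfunP.
  by rewrite inE => -[x _ <-]; rewrite normrM ler_wpM2r.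
rewrite -mulr_sumr ler_wpM2l//; apply: tv_sums_le.
pose B : seq R := fset_set (range s).
exists (size B), (fun i => if (i < size B)%N then s @^-1` [set nth 0 B i]
                           else set0); split.
- by move=> i; case: ifPn => // _; exact: measurable_funPTI.
- apply/trivIsetP => i j /= iB jB ij; rewrite iB jB.
  apply/seteqP; split => // x [/= -> /eqP].
  by rewrite nth_uniq ?fset_uniq// (negbTE ij).
- rewrite (big_nth 0) big_mkord; apply: eq_bigr => i _.
  by rewrite ltn_ord.
Qed.

Let sint_close mu s t e : 0 <= e -> (forall x, `|s x - t x| <= e) ->
  `|sint mu s - sint mu t| <= e * `|mu|.
Proof. by move=> e0 ste; rewrite -sintB; exact: (@sint_bound mu (s - t)). Qed.

Let is_ba_intP mu f I : is_ba_int mu f I <-> exists s : nat -> {sfun X >-> R},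
  (forall e, 0 < e -> \forall n \near \oo, forall x, `|f x - s n x| <= e) /\
  sint mu (s n) @[n --> \oo] --> I.
Proof.
split => -[s [sf sI]]; exists s; split => //.
  move: sI; under eq_fun do rewrite sintegral_sint.
  by move=> /fine_cvgP[].
under eq_fun do rewrite sintegral_sint.
by apply/fine_cvgP; split => //; exact: nearW.
Qed.

Lemma is_ba_intD mu f g I J :
  is_ba_int mu f I -> is_ba_int mu g J -> is_ba_int mu (f \+ g) (I + J).
Proof.
move=> /is_ba_intP[s [sf sI]] /is_ba_intP[t [tg tJ]]; apply/is_ba_intP.
exists (fun n => s n + t n); split; last first.
  rewrite (_ : (fun _ => _) = (fun n => sint mu (s n) + sint mu (t n))).
    exact: cvgD.
  by apply/funext => n; rewrite -sintD.
move=> e e0; have e20 : 0 < e / 2 by rewrite divr_gt0.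
have sfe := sf _ e20; have tge := tg _ e20; near=> n.
have sfn : forall x, `|f x - s n x| <= e / 2 by near: n.
have tgn : forall x, `|g x - t n x| <= e / 2 by near: n.
move=> x /=.
by rewrite opprD addrACA (splitr e) (le_trans (ler_normD _ _))// lerD.
Unshelve. all: by end_near. Qed.

Lemma is_ba_int_close mu f g I J M : 0 <= M -> (forall x, `|f x - g x| <= M) ->
  is_ba_int mu f I -> is_ba_int mu g J -> `|I - J| <= M * `|mu|.
Proof.
move=> M0 fgM /is_ba_intP[s [sf sI]] /is_ba_intP[t [tg tJ]].
have key e : 0 < e -> `|I - J| <= M * `|mu| + e * (2 + 2 * `|mu|).
  move=> e0; have /cvgrPdist_le/(_ e e0) sI' := sI.
  have /cvgrPdist_le/(_ e e0) tJ' := tJ.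
  have [n [[sfn tgn] [sIn tJn]]] := filter_ex
    (filterI (filterI (sf e e0) (tg e e0)) (filterI sI' tJ')).
  have st : `|sint mu (s n) - sint mu (t n)| <= (M + 2 * e) * `|mu|.
    apply: sint_close => [|x]; first by rewrite addr_ge0// mulr_ge0// ltW.
    rewrite (_ : s n x - t n x =
      (f x - g x) + (g x - t n x) - (f x - s n x)); last by ring.
    have := sfn x; have := tgn x; have := fgM x => h1 h2 h3.
    apply: le_trans (ler_normB _ _) _; apply: le_trans (lerD (ler_normD _ _) (lexx _)) _.
    by lra.
  rewrite (_ : I - J = (I - sint mu (s n)) + (sint mu (s n) - sint mu (t n))
    - (J - sint mu (t n))); last by ring.
  apply: le_trans (ler_normB _ _) _; apply: le_trans (lerD (ler_normD _ _) (lexx _)) _.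
  rewrite /= in sIn tJn; move: (sint mu (s n)) (sint mu (t n)) st sIn tJn => a b.
  by move=> st sIn tJn; lra.
apply/ler_addgt0Pr => e e0.
have m0 : 0 < 2 + 2 * `|mu| by rewrite ltr_pwDl// mulr_ge0.
have := key (e / (2 + 2 * `|mu|)); rewrite mulrVK ?unitfE ?gt_eqF//.
by apply; rewrite divr_gt0.
Qed.

Lemma is_ba_int_unique mu f I J :
  is_ba_int mu f I -> is_ba_int mu f J -> I = J.
Proof.
move=> fI fJ; apply/eqP; rewrite -subr_eq0 -normr_le0 -[leRHS](mul0r `|mu|).
by apply: is_ba_int_close fI fJ => // x; rewrite subrr normr0.
Qed.

Let is_ba_int0 mu : is_ba_int mu (cst 0) 0.
Proof.
apply/is_ba_intP; exists (fun=> cst_sfun 0); split.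
  by move=> e e0; apply: nearW => _ x; rewrite subrr normr0 ltW.
rewrite (_ : (fun _ => _) = fun=> 0); first exact: cvg_cst.
apply/funext => _; apply/eqP; rewrite -normr_le0 -[leRHS](mul0r `|mu|).
by apply: sint_bound => // x; rewrite normr0.
Qed.

Lemma is_ba_int_le mu f I M : 0 <= M -> (forall x, `|f x| <= M) ->
  is_ba_int mu f I -> `|I| <= M * `|mu|.
Proof.
move=> M0 fM fI; rewrite -[I]subr0; apply: is_ba_int_close fI (is_ba_int0 mu) => //.
by move=> x; rewrite subr0.
Qed.

Lemma is_ba_int_ex mu f M : measurable_fun setT f -> (forall x, `|f x| <= M) ->
  exists I, is_ba_int mu f I.
Proof.
move=> mf fM.
pose q n (r : R) := (Num.floor (n.+1%:R * r))%:~R / n.+1%:R : R.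
have q_close n r : `|r - q n r| <= n.+1%:R^-1.
  have n0 : 0 < n.+1%:R :> R by rewrite ltr0n.
  rewrite -(ler_pM2l n0) mulfV ?gt_eqF// -{1}(ger0_norm (ltW n0)) -normrM.
  rewrite mulrBr /q mulrCA mulfV ?gt_eqF// mulr1.
  have /andP[h1 h2] := floor_itv (n.+1%:R * r); move: h2; rewrite intrD => h2.
  by rewrite ger0_norm ?subr_ge0//; lra.
have mq n : measurable_fun setT (q n \o f).
  apply: measurableT_comp => //; apply: nondecreasing_measurable => // x y xy.
  rewrite /q ler_wpM2r ?invr_ge0// ler_int.
  by rewrite floor_ge_int (le_trans (floor_le _))// ler_wpM2l.
have fin_q n : finite_set (range (q n \o f)).
  pose K := Num.bound `|n.+1%:R * M|.
  apply: (@sub_finite_set _ _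
    ((fun k : nat => (k%:Z - K%:Z)%:~R / n.+1%:R : R) @` `I_(K + K))); last first.
    by apply: finite_image; exact: finite_II.
  move=> _ [x _ <-] /=; set r := n.+1%:R * f x.
  have rK : `|r| < K%:R.
    rewrite (le_lt_trans _ (archi_boundP (normr_ge0 _)))//.
    rewrite /r normrM ger0_norm// (le_trans _ (ler_norm _))//.
    by rewrite ler_wpM2l.
  move: rK; rewrite ltr_norml => /andP[rK1 rK2].
  have h1 : - K%:Z <= Num.floor r by rewrite floor_ge_int mulrNz ltW.
  have h2 : Num.floor r < K%:Z by rewrite floor_lt_int.
  exists (absz (Num.floor r + K%:Z)%R); first by lia.
  congr (_%:~R / _).
  have : 0 <= Num.floor r + K%:Z by lia.
  by move=> /gez0_abs ->; rewrite addrK.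
have sf n : q n \o f \in sfun.
  by apply/andP; split; rewrite inE; [exact: mq|exact: fin_q].
pose s n : {sfun X >-> R} := sfun_Sub (sf n).
have s_close n x : `|f x - s n x| <= n.+1%:R^-1 by exact: q_close.
have hn (e : R) : 0 < e -> \forall n \near \oo, n.+1%:R^-1 <= e.
  move=> e0; have /cvgrPdist_le/(_ _ e0) := @cvg_harmonic R.
  by apply: filterS => n; rewrite sub0r normrN ger0_norm ?harmonic_ge0.
suff /cauchy_cvg/cvg_ex[I sI] : cauchy (sint mu (s n) @[n --> \oo]).
  exists I; apply/is_ba_intP; exists s; split => // e /hn.
  by apply: filterS => n ne x; exact: le_trans ne.
apply: cauchy_exP => e e0.
have m0 : 0 < 2 * `|mu| + 1 by rewrite ltr_wpDl// mulr_ge0.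
have [N _ hN] := hn (e / (2 * `|mu| + 1)) (divr_gt0 e0 m0).
exists (sint mu (s N)); exists N => // n /= Nn.
suff : `|sint mu (s N) - sint mu (s n)| < e by rewrite -ball_normE.
set e' := e / _ in hN.
have e'0 : 0 < e' by rewrite divr_gt0.
apply: (@le_lt_trans _ _ ((2 * e') * `|mu|)).
  apply: sint_close => [|x]; first by rewrite mulr_ge0// ltW.
  rewrite (_ : s N x - s n x = (f x - s n x) - (f x - s N x)); last by ring.
  have a := le_trans (s_close N x) (hN N (leqnn N)).
  have b := le_trans (s_close n x) (hN n Nn).
  by apply: le_trans (ler_normB _ _) _; lra.
rewrite mulrAC /e' mulrA ltr_pdivrMr// mulrC ltr_pM2l//.
by rewrite ltrDl.
Qed.

Lemma ba_intP mu f M : measurable_fun setT f -> (forall x, `|f x| <= M) ->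
  is_ba_int mu f (ba_int mu f).
Proof.
move=> mf fM; rewrite /ba_int; case: xgetP => [I _ //|no].
by have [I fI] := is_ba_int_ex mu mf fM; have := no I fI.
Qed.

Lemma ba_intE mu f I : is_ba_int mu f I -> ba_int mu f = I.
Proof.
move=> fI; rewrite /ba_int; case: xgetP => [J _ fJ|/(_ I) //].
exact: is_ba_int_unique fJ fI.
Qed.

End ba_integral.

Section linear_bases.
Context {R : realType} {V : lmodType R}.

Definition is_basis n (H : 'I_n -> V) (M : set V) :=
  [/\ forall i, M (H i),
      forall c : 'I_n -> R, \sum_(i < n) c i *: H i = 0 -> forall i, c i = 0
    & forall v, M v -> exists c : 'I_n -> R, v = \sum_(i < n) c i *: H i].

Definition has_dim (M : set V) (n : nat) := exists H : 'I_n -> V, is_basis H M.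

End linear_bases.

Definition compact_operator {R : realType} {U V : normedModType R} (T : U -> V) :=
  precompact (T @` [set u | `|u| <= 1]).

(* The supremum is taken in \bar R, so that it is +oo for an unbounded map. *)
Definition op_norm {R : realType} {U V : normedModType R} (T : U -> V) : \bar R :=
  ereal_sup [set `|T u|%:E | u in [set u | `|u| <= 1]].

Section measures.
Context {d : measure_display} {X : measurableType d} {R : realType}.
Implicit Types mu nu : ba X R.

Definition S_ba : set (ba X R) := [set mu : ba X R | 0 <= mu /\ `|mu| = 1].

Definition disjoint_ba mu nu := infimums [set mu; nu] 0.

Definition singular_ba mu nu := exists D1 D2 : set X,
  [/\ measurable D1, measurable D2, D1 `&` D2 = set0,
      mu D1 = mu setT & nu D2 = nu setT].

End measures.

Section markov_chain.
Context {d : measure_display} {X : measurableType d} {R : realType}.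
Variable p : R.-pker X ~> X.
Implicit Types (mu nu : ba X R) (E K : set X).

(* The k-step transition function; only k >= 1 is meaningful. *)
Definition kiter (k : nat) : X -> set X -> \bar R :=
  iter k.-1 (fun q x E => (\int[p x]_y q y E)%E) (fun x E => p x E).

Definition markov_fun mu E : R :=
  if `[< measurable E >] then ba_int mu (fun x => fine (p x E)) else 0.

Let p_fin x E : measurable E -> p x E \is a fin_num.
Proof. exact: kernel_finite_transition. Qed.

Let p_le1 x E : measurable E -> `|fine (p x E)| <= 1.
Proof.
move=> mE; rewrite ger0_norm ?fine_ge0// -lee_fin fineK ?p_fin//.
by rewrite -(prob_kernel (s := p) x) le_measure ?inE.
Qed.

Let p_meas E : measurable E -> measurable_fun setT (fun x => fine (p x E)).
Proof. by move=> mE; apply: measurableT_comp => //; exact: measurable_kernel. Qed.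

Lemma markov_funP mu E : measurable E ->
  is_ba_int mu (fun x => fine (p x E)) (markov_fun mu E).
Proof.
move=> mE; rewrite /markov_fun asboolT//.
by apply: (@ba_intP _ _ _ _ _ 1); [exact: p_meas|move=> x; exact: p_le1].
Qed.

Fact markov_ba mu : markov_fun mu \in @ba_pred d X R.
Proof.
rewrite inE; split.
- move=> A B mA mB AB /=; rewrite -EFinD; congr EFin.
  apply: is_ba_int_unique (markov_funP mu (measurableU _ _ mA mB)) _.
  rewrite (_ : (fun x => _) = (fun x => fine (p x A)) \+ (fun x => fine (p x B))).
    by apply: is_ba_intD; exact: markov_funP.
  by apply/funext => x /=; rewrite measureU// fineD// p_fin.
- exists (1 * `|mu|) => E mE.
  by apply: is_ba_int_le (markov_funP mu mE) => // x; exact: p_le1.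
- by move=> E nE; rewrite /markov_fun asboolF.
Qed.

Definition markov_op mu : ba X R := Ba (markov_ba mu).

Definition M_ba : set (ba X R) := [set mu | markov_op mu = mu].

Definition Delta_ba : set (ba X R) := S_ba `&` M_ba.

Definition disjoint_basis n (H : 'I_n -> ba X R) :=
  [/\ is_basis H M_ba, forall i, Delta_ba (H i)
    & forall i j, i != j -> disjoint_ba (H i) (H j)].

Definition stochastically_closed K := forall x, K x -> p x K = 1%E.

Definition condition_alpha := forall mu, Delta_ba mu ->
  forall Kmu, measurable Kmu -> mu Kmu = 1 ->
  exists K, [/\ K `<=` Kmu, measurable K, mu K = 1 & stochastically_closed K].

Definition condition_beta n (H : 'I_n -> ba X R) :=
  forall i j, i != j -> singular_ba (H i) (H j).

Definition condition_star := forall mu, Delta_ba mu -> is_ca mu.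

Definition condition_D := exists (phi : ca X R) (eps : R) (k : nat),
  [/\ 0 <= ca_ba phi, 0 < eps, (1 <= k)%N
    & forall E, measurable E -> phi E <= eps ->
      forall x, (kiter k x E <= (1 - eps)%:E)%E].

Definition condition_Dtilde := exists (phi : ca X R) (eps : R) (m : nat),
  [/\ 0 <= ca_ba phi, 0 < eps, (1 <= m)%N
    & forall E, measurable E -> phi E < eps ->
      forall x, ((m%:R^-1)%:E * \sum_(1 <= k < m.+1) kiter k x E
                 <= (1 - eps)%:E)%E].

(* ca is normed as a subspace of ba, so the norm of the difference on ca can be
   computed in ba. *)
Definition condition_K := exists (A1 : {linear ca X R -> ca X R}) (k : nat),
  [/\ compact_operator A1, (1 <= k)%N
    & (op_norm (fun mu : ca X R => (iter k markov_op mu - ca_ba (A1 mu))%R)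
       < 1)%E].

End markov_chain.

(* Main.v *)
(** Let A be the Markov operator and T its transpose on bounded measurable
functions.  Cesaro averages of T along an ultrafilter produce invariant measures
in ba.  By (alpha) and (beta) the basis measures mu_i have disjoint closed
supports K_i, so that every invariant probability nu is the combination of the
mu_i with coefficients nu(K_i), and every ultralimit started in K_i is mu_i.
Hence the averages of p^k(x, .), for x in K_i, converge setwise to mu_i, which
is therefore countably additive by Nikodym's theorem.

The mean phi of the mu_i is then countably additive and dominates all invariant
probabilities up to a constant.  An ultralimit nu with nu(E_j) not small while
phi(E_j) is summable would contradict this, so the averages of p^k(x, .) are
absolutely continuous with respect to phi, uniformly in x; the invariance of phi
transfers this to p^m(x, .) for a single m, whence (D) and (D~).

For (K), an energy increment argument (the weak regularity lemma) approximates
phi(dx) p^m(x, dy) in the cut norm by a step kernel Q.  As p^l(x, .) is nearly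
absolutely continuous with respect to phi, uniformly in x, the operator A^m A^l
is close in norm to the composition of A^l with Q, which has finite rank.  No
density of p^m(x, .) and no separability of the sigma-algebra are needed. *)

From HB Require Import structures.
Require Import Defs.
From mathcomp Require Import all_boot all_order all_algebra.
From mathcomp Require Import finmap.
From mathcomp Require Import all_classical all_reals all_analysis.
From mathcomp Require Import measurable_realfun ring lra zify.

Set Implicit Arguments.
Unset Strict Implicit.
Unset Printing Implicit Defensive.
Import Order.TTheory GRing.Theory Num.Theory.
Import numFieldNormedType.Exports.
Local Open Scope classical_set_scope.
Local Open Scope ring_scope.

(** * Integration against finitely additive measures *)

Section bounded_measurable.
Import HBSimple.
Context {d : measure_display} {X : measurableType d} {R : realType}.
Implicit Types (f g : X -> R) (E : set X) (mu nu : ba X R).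

Definition bmf f := measurable_fun setT f /\ exists M, forall x, `|f x| <= M.

Lemma bmf_bound f : bmf f -> exists2 M, 0 <= M & forall x, `|f x| <= M.
Proof.
by move=> [_ [M fM]]; exists `|M| => // x; exact: le_trans (fM x) (ler_norm M).
Qed.

Lemma bmf_cst (c : R) : bmf (fun=> c).
Proof. by split; [exact: measurable_cst|exists `|c|]. Qed.

Lemma bmf_indic E : measurable E -> bmf \1_E.
Proof.
move=> mE; split; first exact: measurable_indic.
by exists 1 => x; rewrite indicE; case: (_ \in _); rewrite ?normr0 ?normr1.
Qed.

Lemma bmfD f g : bmf f -> bmf g -> bmf (fun x => f x + g x).
Proof.
move=> [mf [M fM]] [mg [N gN]]; split; first exact: measurable_funD.
by exists (M + N) => x; rewrite (le_trans (ler_normD _ _))// lerD.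
Qed.

Lemma bmfM f g : bmf f -> bmf g -> bmf (fun x => f x * g x).
Proof.
move=> bf bg; have [M M0 fM] := bmf_bound bf; have [N N0 gN] := bmf_bound bg.
split; first by apply: measurable_funM; [exact: bf.1|exact: bg.1].
by exists (M * N) => x; rewrite normrM ler_pM.
Qed.

Lemma bmfZ (c : R) f : bmf f -> bmf (fun x => c * f x).
Proof. exact/bmfM/bmf_cst. Qed.

Lemma bmfN f : bmf f -> bmf (fun x => - f x).
Proof.
by move=> /(bmfZ (-1)); congr bmf; apply/funext => x; rewrite mulN1r.
Qed.

Lemma bmfB f g : bmf f -> bmf g -> bmf (fun x => f x - g x).
Proof. by move=> bf bg; apply: bmfD => //; exact: bmfN. Qed.

Lemma bmf_norm f : bmf f -> bmf (fun x => `|f x|).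
Proof.
move=> [mf [M fM]]; split; first exact: measurableT_comp.
by exists M => x; rewrite normr_id.
Qed.

Lemma bmf_sum (I : Type) (r : seq I) (P : pred I) (F : I -> X -> R) :
  (forall i, bmf (F i)) -> bmf (fun x => \sum_(i <- r | P i) F i x).
Proof.
move=> bF; elim: r => [|i r IH].
  by rewrite (_ : (fun _ => _) = fun=> 0);
    [exact: bmf_cst|apply/funext => x; rewrite big_nil].
case: (boolP (P i)) => Pi.
  rewrite (_ : (fun _ => _) = fun x => F i x + \sum_(i <- r | P i) F i x).
    exact: bmfD.
  by apply/funext => x; rewrite big_cons Pi.
by move: IH; congr bmf; apply/funext => x; rewrite big_cons (negbTE Pi).
Qed.

Lemma bmf_sfun (s : {sfun X >-> R}) : bmf s.
Proof.
split; first exact: measurable_funPT.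
have fs := fimfunP s; pose r : seq R := fset_set (range s).
exists (\sum_(c <- r) `|c|) => x.
have xr : s x \in r by rewrite in_fset_set// inE; exists x.
by rewrite (big_rem (s x))//= lerDl sumr_ge0.
Qed.

Lemma bmf_approx f e : bmf f -> 0 < e ->
  exists s : {sfun X >-> R}, forall x, `|f x - s x| <= e.
Proof.
move=> [mf [M fM]] e0; have [s [sf _]] := ba_intP 0 mf fM.
have [N _ sN] := sf e e0; exists (s N) => x; exact: sN N (leqnn N) x.
Qed.

Lemma ba_intD mu f g : bmf f -> bmf g ->
  ba_int mu (fun x => f x + g x) = ba_int mu f + ba_int mu g.
Proof.
move=> [mf [M fM]] [mg [N gN]]; apply: ba_intE.
by apply: is_ba_intD; [exact: ba_intP fM|exact: ba_intP gN].
Qed.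

Lemma ba_int_close mu f g e : bmf f -> bmf g -> 0 <= e ->
  (forall x, `|f x - g x| <= e) -> `|ba_int mu f - ba_int mu g| <= e * `|mu|.
Proof.
move=> [mf [M fM]] [mg [N gN]] e0 fg.
by apply: is_ba_int_close fg _ _ => //; [exact: ba_intP fM|exact: ba_intP gN].
Qed.

(** A scaled indicator is already simple, so a constant sequence computes its integral. The factor
    [c] is included because homogeneity, [ba_intZ], is derived from this case. *)
Lemma ba_int_indicZ mu (c : R) E : measurable E ->
  ba_int mu (fun x => c * \1_E x) = c * mu E.
Proof.
move=> mE; apply: ba_intE.
pose h := fun x => c * \1_E x : R.
have finh : finite_set (range h).
  apply: (@sub_finite_set _ _ [set 0; c]); last exact: finite_set2.
  move=> _ [x _ <-]; rewrite /h indicE; case: (_ \in _) => /=.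
    by right; rewrite mulr1.
  by left; rewrite mulr0.
have sh : h \in sfun.
  by apply/andP; split; rewrite inE;
    [exact: (bmfZ c (bmf_indic mE)).1|exact: finh].
pose s : {sfun X >-> R} := sfun_Sub sh.
exists (fun=> s); split.
  by move=> e e0; apply: nearW => _ x; rewrite subrr normr0 ltW.
rewrite (_ : (fun _ => _) = fun=> (c * mu E)%:E); first exact: cvg_cst.
apply/funext => _; rewrite /sintegral.
(* Only the value [c] contributes: the value 0 is weighted by 0, and any other value has an empty
   fibre. *)
rewrite -(fsbig_widen [set c] setT) //=.
  rewrite fsbig_set1 -EFinM; have [->|c0] := eqVneq c 0; first by rewrite !mul0r.
  congr ((_ * mu _)%:E); apply/seteqP; split => x /=; rewrite /s/= /h indicE.
    case: (boolP (x \in E)) => [/set_mem//|_] /eqP.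
    by rewrite mulr0 eq_sym (negbTE c0).
  by move=> Ex; rewrite mem_set// mulr1.
move=> y [_ /= yc]; have [->|y0] := eqVneq y 0; first by rewrite mul0e.
rewrite (_ : _ @^-1` _ = set0) ?ba_set0 ?mule0//.
apply/seteqP; split => // x /=; rewrite /s/= /h indicE.
case: (_ \in _); first by rewrite mulr1 => /esym.
by rewrite mulr0 => /eqP; rewrite eq_sym (negbTE y0).
Qed.

Lemma sum_of_indic (L : (X -> R) -> R) mu (s : {sfun X >-> R}) :
  (forall f g, bmf f -> bmf g -> L (fun x => f x + g x) = L f + L g) ->
  (forall c E, measurable E -> L (fun x => c * \1_E x) = c * mu E) ->
  L s = \sum_(c <- fset_set (range s)) c * mu (s @^-1` [set c]).
Proof.
move=> LD LI.
rewrite {1}(_ : (s : X -> R) = fun x => \sum_(c <- fset_set (range s))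
    c * \1_(s @^-1` [set c]) x); last first.
  by apply/funext => x; rewrite {1}fimfunE fsbig_finite.
elim: (enum_fset _) => [|c r IH].
  rewrite big_nil (_ : (fun _ => _) = fun x => 0 * \1_(@set0 X) x).
    by rewrite LI// mul0r.
  by apply/funext => x; rewrite big_nil mul0r.
have mc c' : measurable (s @^-1` [set c']) by exact: measurable_funPTI.
rewrite big_cons (_ : (fun _ => _) = fun x => c * \1_(s @^-1` [set c]) x +
    \sum_(c <- r) c * \1_(s @^-1` [set c]) x); last first.
  by apply/funext => x; rewrite big_cons.
rewrite LD ?LI ?IH//; first exact/bmfZ/bmf_indic.
by apply: bmf_sum => c'; exact/bmfZ/bmf_indic.
Qed.

(** Simple functions are uniformly dense, so additivity, the values on scaled indicators and a
    sup-norm Lipschitz bound determine [L]. This yields homogeneity, linearity in the measure,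
    duality with the chain and the integral form of ultralimits. *)
Lemma ba_int_unique (L : (X -> R) -> R) mu (C : R) :
  (forall f g, bmf f -> bmf g -> L (fun x => f x + g x) = L f + L g) ->
  (forall c E, measurable E -> L (fun x => c * \1_E x) = c * mu E) ->
  (forall f g e, bmf f -> bmf g -> 0 <= e -> (forall x, `|f x - g x| <= e) ->
    `|L f - L g| <= e * C) ->
  forall f, bmf f -> L f = ba_int mu f.
Proof.
move=> LD LI LC f bf; apply/eqP; rewrite -subr_eq0 -normr_le0.
apply/ler_addgt0Pr => e e0; rewrite add0r.
have k0 : 0 < `|C| + `|mu| + 1 by rewrite ltr_pwDr// addr_ge0.
have [s fs] := bmf_approx bf (divr_gt0 e0 k0).
have e'0 : 0 <= e / (`|C| + `|mu| + 1) by rewrite divr_ge0// ltW.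
have Ls : L s = ba_int mu s.
  rewrite (sum_of_indic s LD LI) (sum_of_indic (L := ba_int mu) (mu := mu))//.
  - by move=> g h; exact: ba_intD.
  - by move=> c E; exact: ba_int_indicZ.
have := LC _ _ _ bf (bmf_sfun s) e'0 fs.
have := ba_int_close mu bf (bmf_sfun s) e'0 fs.
rewrite Ls; set I := ba_int mu s; set J := ba_int mu f => h1 h2.
rewrite (_ : L f - J = (L f - I) - (J - I)); last by ring.
rewrite (le_trans (ler_normB _ _))//; apply: (le_trans (lerD h2 h1)).
rewrite -mulrDr mulrAC ler_pdivrMr// ler_wpM2l ?ltW//.
by have := ler_norm C; lra.
Qed.

Lemma ba_int_indic mu E : measurable E -> ba_int mu \1_E = mu E.
Proof.
move=> mE; rewrite -[RHS]mul1r -ba_int_indicZ//; congr ba_int.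
by apply/funext => x; rewrite mul1r.
Qed.

Lemma ba_intZ mu (a : R) f : bmf f ->
  ba_int mu (fun x => a * f x) = a * ba_int mu f.
Proof.
have [->|a0] := eqVneq a 0 => bf.
  rewrite mul0r -[RHS](mul0r (mu set0)) -ba_int_indicZ//.
  by congr ba_int; apply/funext => x; rewrite !mul0r.
suff <- : a^-1 * ba_int mu (fun x => a * f x) = ba_int mu f.
  by rewrite mulrA mulfV// mul1r.
apply: (@ba_int_unique (fun f => a^-1 * ba_int mu (fun x => a * f x)) mu `|mu|) => //.
- move=> g h bg bh; rewrite -mulrDr -ba_intD; [|exact: bmfZ..].
  by congr (_ * ba_int _ _); apply/funext => x; rewrite mulrDr.
- move=> c E mE; rewrite (_ : (fun x => _) = fun x => (a * c) * \1_E x).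
    by rewrite ba_int_indicZ// !mulrA mulVf// mul1r.
  by apply/funext => x; rewrite mulrA.
- move=> g h e bg bh e0 gh; rewrite -mulrBr normrM normfV.
  rewrite ler_pdivrMl ?normr_gt0// mulrA.
  apply: ba_int_close; [exact: bmfZ|exact: bmfZ|by rewrite mulr_ge0|].
  by move=> x; rewrite -mulrBr normrM ler_wpM2l.
Qed.

Lemma ba_int_cst mu (c : R) : ba_int mu (fun=> c) = c * mu setT.
Proof.
rewrite -ba_int_indicZ//; congr ba_int; apply/funext => x.
by rewrite indicT mulr1.
Qed.

Lemma ba_intB mu f g : bmf f -> bmf g ->
  ba_int mu (fun x => f x - g x) = ba_int mu f - ba_int mu g.
Proof.
move=> bf bg; rewrite ba_intD//; last exact: bmfN.
congr (_ + _); rewrite -mulN1r -ba_intZ//; congr ba_int.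
by apply/funext => x; rewrite mulN1r.
Qed.

Lemma ba_int_sum mu (I : Type) (r : seq I) (P : pred I) (F : I -> X -> R) :
  (forall i, bmf (F i)) ->
  ba_int mu (fun x => \sum_(i <- r | P i) F i x) =
  \sum_(i <- r | P i) ba_int mu (F i).
Proof.
move=> bF; elim: r => [|i r IH].
  rewrite big_nil (_ : (fun _ => _) = fun=> 0) ?ba_int_cst ?mul0r//.
  by apply/funext => x; rewrite big_nil.
rewrite big_cons -IH; case: ifPn => Pi.
  rewrite -ba_intD//; last exact: bmf_sum.
  by congr ba_int; apply/funext => x; rewrite big_cons Pi.
by congr ba_int; apply/funext => x; rewrite big_cons (negbTE Pi).
Qed.

Lemma ba_int_le_norm mu f M : bmf f -> 0 <= M -> (forall x, `|f x| <= M) ->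
  `|ba_int mu f| <= M * `|mu|.
Proof.
by move=> [mf _] M0 fM; apply: is_ba_int_le (fM) (ba_intP mu mf fM).
Qed.

Lemma ba_ge0P mu : reflect (forall E, measurable E -> 0 <= mu E) (0 <= mu).
Proof. by apply: (iffP (ba_leP 0 mu)) => h E /h; rewrite ba_0E. Qed.

Lemma ba_nneg mu E : 0 <= mu -> 0 <= mu E.
Proof.
move=> /ba_ge0P mu0; have [mE|nE] := pselect (measurable E); first exact: mu0.
by rewrite ba_nonmeasurable.
Qed.

Lemma ba_mono mu A B : 0 <= mu -> measurable A -> measurable B -> A `<=` B ->
  mu A <= mu B.
Proof.
move=> mu0 mA mB AB; rewrite -(setDUK AB) ba_add//.
- by rewrite lerDl ba_nneg.
- exact: measurableD.
- by rewrite setDIK.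
Qed.

Lemma ba_setC mu A : measurable A -> mu (~` A) = mu setT - mu A.
Proof.
move=> mA; rewrite -(setvU A) ba_add ?addrK//; first exact: measurableC.
by rewrite setICl.
Qed.

Lemma ba_setD mu A B : measurable A -> measurable B -> B `<=` A ->
  mu (A `\` B) = mu A - mu B.
Proof.
move=> mA mB BA; rewrite -{2}(setDUK BA) ba_add ?setDIK//; last exact: measurableD.
by ring.
Qed.

Lemma ba_le_setU mu A B : 0 <= mu -> measurable A -> measurable B ->
  mu (A `|` B) <= mu A + mu B.
Proof.
move=> mu0 mA mB; have -> : A `|` B = A `|` (B `\` A).
  apply/seteqP; split => x; last by move=> [|[]]; [left|right].
  by have [|nA [//|]] := pselect (A x); [left|right].
have mBA : measurable (B `\` A) by exact: measurableD.
by rewrite ba_add ?setDIK// lerD2l ba_mono// => x [].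
Qed.

Lemma nneg_norm mu : 0 <= mu -> `|mu| = mu setT.
Proof.
move=> mu0; apply/eqP; rewrite eq_le; apply/andP; split; last first.
  by rewrite -[leLHS]ger0_norm ?ba_nneg// ba_le_tv.
apply: tv_le => _ [n [E [mE /trivIsetP tE ->]]].
rewrite (eq_bigr (fun i : 'I_n => mu (E i))); last first.
  by move=> i _; rewrite ger0_norm// ba_nneg.
rewrite -(big_mkord xpredT (fun i => mu (E i))) -ba_big//; first last.
- move=> i j; rewrite !mem_index_iota => ilt jlt ij.
  by apply: tE => //=; lia.
- exact: iota_uniq.
by apply: ba_mono => //; exact: bigsetU_measurable.
Qed.

(** With 0 <= f <= M, the bound |M - f| <= M gives M mu(X) - int f <= M mu(X). *)
Lemma ba_int_ge0 mu f : 0 <= mu -> bmf f -> (forall x, 0 <= f x) ->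
  0 <= ba_int mu f.
Proof.
move=> mu0 bf f0; have [M M0 fM] := bmf_bound bf.
have bg := bmfB (bmf_cst M) bf.
have := @ba_int_le_norm mu _ M bg M0; rewrite ba_intB//; last exact: bmf_cst.
rewrite ba_int_cst nneg_norm// ler_norml => H.
suff /H/andP[_] : forall x, `|M - f x| <= M by lra.
move=> x; have := fM x; have := f0 x => fx0; rewrite ger0_norm// => fxM.
by rewrite ger0_norm; lra.
Qed.

Lemma ba_int_mono mu f g : 0 <= mu -> bmf f -> bmf g ->
  (forall x, f x <= g x) -> ba_int mu f <= ba_int mu g.
Proof.
move=> mu0 bf bg fg; rewrite -subr_ge0 -ba_intB//.
by apply: ba_int_ge0 => //; [exact: bmfB|move=> x; rewrite subr_ge0].
Qed.

(** Markov's inequality: [f] dominates [a] times the indicator of the set where it exceeds [a]. *)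
Lemma ba_markov mu f (a : R) : 0 <= mu -> bmf f -> (forall x, 0 <= f x) ->
  measurable [set x | a < f x] -> a * mu [set x | a < f x] <= ba_int mu f.
Proof.
move=> mu0 bf f0 mG; rewrite -ba_int_indicZ//.
apply: ba_int_mono => //; first exact/bmfZ/bmf_indic.
move=> x; rewrite indicE; case: (boolP (x \in _)) => [/set_mem/=|_].
  by rewrite mulr1 => /ltW.
by rewrite mulr0.
Qed.

Lemma bmf_gt_measurable f (a : R) : bmf f -> measurable [set x | a < f x].
Proof.
move=> [mf _]; rewrite (_ : [set x | _] = setT `&` f @^-1` `]a, +oo[).
  exact: mf.
by rewrite setTI; apply/seteqP; split => x /=; rewrite in_itv/= andbT.
Qed.

(** Turns a bound uniform over single sets into a total variation bound: the cells of nonnegative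
    and those of negative mass are each merged into one set, whence the factor 2. *)
Lemma norm_le_twice mu (M : R) : (forall E, measurable E -> `|mu E| <= M) ->
  `|mu| <= M + M.
Proof.
move=> muM; apply: tv_le => _ [n [E [mE /trivIsetP tE ->]]].
rewrite -(big_mkord xpredT (fun i => `|mu (E i)|)).
have key (P : pred nat) : `|\sum_(0 <= i < n | P i) mu (E i)| <= M.
  rewrite -big_filter -ba_big ?filter_uniq ?iota_uniq//.
    by apply: muM; exact: bigsetU_measurable.
  move=> i j; rewrite !mem_filter !mem_index_iota => /andP[_ /andP[_ ilt]].
  by move=> /andP[_ /andP[_ jlt]] ij; exact: tE.
rewrite (bigID (fun i => 0 <= mu (E i))) /=; apply: lerD.
  rewrite (eq_bigr (fun i => mu (E i))) ?(le_trans (ler_norm _) (key _))//.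
  by move=> i /ger0_norm.
rewrite (eq_bigr (fun i => - mu (E i))).
  rewrite sumrN -[leRHS]opprK lerN2.
  by have := key (fun i => ~~ (0 <= mu (E i))); rewrite ler_norml => /andP[].
by move=> i; rewrite -ltNge => /ltr0_norm.
Qed.

End bounded_measurable.

(** * The transition operator on bounded measurable functions *)

Section transition_operator.
Context {d : measure_display} {X : measurableType d} {R : realType}.
Variable p : R.-pker X ~> X.
Implicit Types (f g : X -> R) (E : set X) (mu nu : ba X R).

Lemma ba_int_linear (a : R) mu nu f : bmf f ->
  ba_int (a *: mu + nu) f = a * ba_int mu f + ba_int nu f.
Proof.
move=> bf; symmetry.
apply: (@ba_int_unique _ _ _ (fun f => a * ba_int mu f + ba_int nu f) _
  (`|a| * `|mu| + `|nu|)) => //.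
- by move=> g h bg bh; rewrite !ba_intD//; ring.
- by move=> c E mE; rewrite !ba_int_indicZ// ba_addE ba_scaleE; ring.
- move=> g h e bg bh e0 gh.
  rewrite opprD addrACA -mulrBr (le_trans (ler_normD _ _))// [leRHS]mulrDr.
  by rewrite lerD ?ba_int_close// normrM mulrCA ler_wpM2l// ba_int_close.
Qed.

(** The operator T, the transpose of the Markov operator. *)
Definition trans f : X -> R := fun x => \int[p x]_y f y.

Lemma bmf_integrable f x : bmf f -> (p x).-integrable setT (EFin \o f).
Proof.
move=> [mf [M fM]]; apply: measurable_bounded_integrable => //.
  by rewrite prob_kernel ltry.
by exists M; split; [exact: num_real|move=> N MN y _; exact: le_trans (fM y) (ltW MN)].
Qed.

Lemma transD f g : bmf f -> bmf g ->
  trans (fun x => f x + g x) = fun x => trans f x + trans g x.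
Proof.
move=> bf bg; apply/funext => x.
by rewrite /trans RintegralD//; exact: bmf_integrable.
Qed.

Lemma transZ (a : R) f : bmf f -> trans (fun x => a * f x) = fun x => a * trans f x.
Proof.
move=> bf; apply/funext => x.
by rewrite /trans RintegralZl//; exact: bmf_integrable.
Qed.

Lemma trans_cst (c : R) : trans (fun=> c) = fun=> c.
Proof. by apply/funext => x; rewrite /trans Rintegral_cst// prob_kernel mulr1. Qed.

Lemma trans_mono f g : bmf f -> bmf g -> (forall x, f x <= g x) ->
  forall x, trans f x <= trans g x.
Proof. by move=> bf bg fg x; apply: le_Rintegral => //; exact: bmf_integrable. Qed.

Lemma trans_indic E : measurable E -> trans \1_E = fun x => fine (p x E).
Proof.
by move=> mE; apply/funext => x; rewrite /trans/Rintegral integral_indic// setIT.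
Qed.

Lemma trans_normr_le f (M : R) : bmf f -> (forall x, `|f x| <= M) ->
  forall x, `|trans f x| <= M.
Proof.
move=> bf fM x; rewrite ler_norml.
have := trans_mono (bmf_cst (- M)) bf _ x; have := trans_mono bf (bmf_cst M) _ x.
rewrite !trans_cst => h1 h2; rewrite h1 ?h2// => y.
  by have := fM y; rewrite ler_norml => /andP[].
by have := fM y; rewrite ler_norml => /andP[].
Qed.

Lemma bmf_trans f : bmf f -> bmf (trans f).
Proof.
move=> bf; have [M M0 fM] := bmf_bound bf.
split; last by exists M; exact: trans_normr_le.
(* Adding [M] makes the integrand nonnegative, the case in which a kernel integral is known to be
   measurable. *)
rewrite (_ : trans f = fun x => trans (fun y => f y + M) x - M); last first.
  apply/funext => x; rewrite transD//; last exact: bmf_cst.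
  by rewrite trans_cst addrK.
apply: measurable_funB => //; apply: measurableT_comp => //.
apply: measurable_fun_integral_kernel => //.
- by move=> U mU; exact: measurable_kernel.
- move=> y; rewrite lee_fin; have := fM y; rewrite ler_norml => /andP[+ _].
  by rewrite -lerBlDr sub0r.
- by apply/measurable_EFinP; exact: (bmfD bf (bmf_cst M)).1.
Qed.

Definition transn k f : X -> R := iter k trans f.

Lemma bmf_transn k f : bmf f -> bmf (transn k f).
Proof. by move=> bf; elim: k => //= k; exact: bmf_trans. Qed.

Lemma transn_add j k f : transn (j + k) f = transn j (transn k f).
Proof. exact: iterD. Qed.

Lemma transnD k f g : bmf f -> bmf g ->
  transn k (fun x => f x + g x) = fun x => transn k f x + transn k g x.
Proof.
move=> bf bg; elim: k => // k IH.
by rewrite /transn/= -/(transn _ _) IH transD//; exact: bmf_transn.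
Qed.

Lemma transnZ k (a : R) f : bmf f ->
  transn k (fun x => a * f x) = fun x => a * transn k f x.
Proof.
move=> bf; elim: k => // k IH.
by rewrite /transn/= -/(transn _ _) IH transZ//; exact: bmf_transn.
Qed.

Lemma transn_cst k (c : R) : transn k (fun=> c) = fun=> c.
Proof. by elim: k => // k IH; rewrite /transn/= -/(transn _ _) IH trans_cst. Qed.

Lemma transn_mono k f g : bmf f -> bmf g -> (forall x, f x <= g x) ->
  forall x, transn k f x <= transn k g x.
Proof.
move=> bf bg fg; elim: k => //= k IH x.
by apply: trans_mono => //; exact: bmf_transn.
Qed.

Lemma transn_normr_le k f (M : R) : bmf f -> (forall x, `|f x| <= M) ->
  forall x, `|transn k f x| <= M.
Proof.
by move=> bf fM; elim: k => // k IH; apply: trans_normr_le => //; exact: bmf_transn.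
Qed.

Lemma transn_ge0 k f : bmf f -> (forall x, 0 <= f x) ->
  forall x, 0 <= transn k f x.
Proof.
by move=> bf f0 x; have := transn_mono k (bmf_cst 0) bf f0 x; rewrite transn_cst.
Qed.

Lemma transnN k f : bmf f -> transn k (fun x => - f x) = fun x => - transn k f x.
Proof.
move=> bf; rewrite (_ : (fun x => _) = fun x => -1 * f x).
  by rewrite transnZ//; apply/funext => x; rewrite mulN1r.
by apply/funext => x; rewrite mulN1r.
Qed.

Lemma transnB k f g : bmf f -> bmf g ->
  transn k (fun x => f x - g x) = fun x => transn k f x - transn k g x.
Proof. by move=> bf bg; rewrite transnD ?transnN//; exact: bmfN. Qed.

Lemma transn_sum k (I : Type) (r : seq I) (P : pred I) (F : I -> X -> R) :
  (forall i, bmf (F i)) ->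
  transn k (fun x => \sum_(i <- r | P i) F i x) =
  fun x => \sum_(i <- r | P i) transn k (F i) x.
Proof.
move=> bF; elim: r => [|i r IH].
  rewrite (_ : (fun _ => _) = fun=> 0) ?transn_cst//.
    by apply/funext => x; rewrite big_nil.
  by apply/funext => x; rewrite big_nil.
have [Pi|Pi] := boolP (P i).
  rewrite (_ : (fun _ => _) = fun x => F i x + \sum_(i <- r | P i) F i x).
    rewrite transnD//; last exact: bmf_sum.
    by rewrite IH; apply/funext => x; rewrite big_cons Pi.
  by apply/funext => x; rewrite big_cons Pi.
rewrite (_ : (fun _ => _) = fun x => \sum_(i <- r | P i) F i x).
  by rewrite IH; apply/funext => x; rewrite big_cons (negbTE Pi).
by apply/funext => x; rewrite big_cons (negbTE Pi).
Qed.

Lemma transn_indic_ge0 k E x : measurable E -> 0 <= transn k \1_E x.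
Proof.
by move=> mE; apply: transn_ge0; [exact: bmf_indic|move=> y; rewrite indicE].
Qed.

Lemma transn_indic_le1 k E x : measurable E -> transn k \1_E x <= 1.
Proof.
move=> mE; have := @transn_mono k \1_E (fun=> 1) (bmf_indic mE) (bmf_cst 1) _ x.
by rewrite transn_cst; apply => y; rewrite indicE; case: (_ \in _).
Qed.

Lemma transn_indic_mono k A B x : measurable A -> measurable B -> A `<=` B ->
  transn k \1_A x <= transn k \1_B x.
Proof.
move=> mA mB AB; apply: transn_mono; [exact: bmf_indic..|].
move=> y; rewrite !indicE; case: (boolP (y \in A)) => [/set_mem/AB yB|_].
  by rewrite mem_set.
by case: (_ \in _).
Qed.

Lemma indicU_disj (A B : set X) : A `&` B = set0 ->
  \1_(A `|` B) = (fun x => \1_A x + \1_B x) :> (X -> R).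
Proof.
move=> AB; apply/funext => x; rewrite !indicE in_setU.
case: (boolP (x \in A)) => [/set_mem xA|_];
  case: (boolP (x \in B)) => [/set_mem xB|_] /=;
  rewrite ?addr0 ?add0r//.
by have : (A `&` B) x by []; rewrite AB.
Qed.

Lemma transn_indicU k A B x : measurable A -> measurable B -> A `&` B = set0 ->
  transn k \1_(A `|` B) x = transn k \1_A x + transn k \1_B x.
Proof. by move=> mA mB AB; rewrite indicU_disj// transnD//; exact: bmf_indic. Qed.

(** The two counts differ at 0: [kiter p 0] is again [p], because of [k.-1], while [transn p 0] is
    the identity. *)
Lemma kiterE k x E : (0 < k)%N -> measurable E ->
  kiter p k x E = (transn k \1_E x)%:E.
Proof.
case: k => // k _ mE; rewrite /kiter/=; elim: k x => [|k IH] x /=.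
  by rewrite -/(trans _) trans_indic// fineK// kernel_finite_transition.
under eq_integral do rewrite IH.
rewrite -[in RHS]/(trans (transn k.+1 \1_E) x) /trans/Rintegral fineK//.
apply: integrable_fin_num => //.
exact: (bmf_integrable x (bmf_transn k.+1 (bmf_indic mE))).
Qed.

Lemma markov_opE mu E : measurable E -> markov_op p mu E = ba_int mu (trans \1_E).
Proof. by move=> mE; rewrite trans_indic//=/markov_fun asboolT. Qed.

(** Duality of the Markov operator and [trans]: on indicators it is the definition, and
    [ba_int_unique] extends it. *)
Lemma ba_int_markov_op mu f : bmf f ->
  ba_int (markov_op p mu) f = ba_int mu (trans f).
Proof.
move=> bf; symmetry.
apply: (@ba_int_unique _ _ _ (fun f => ba_int mu (trans f)) _ `|mu|) => //.
- by move=> g h bg bh; rewrite transD// ba_intD//; exact: bmf_trans.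
- move=> c E mE; rewrite transZ; last exact: bmf_indic.
  by rewrite ba_intZ ?markov_opE//; exact/bmf_trans/bmf_indic.
- move=> g h e bg bh e0 gh; apply: ba_int_close => //; [exact: bmf_trans..|].
  move=> x; have := @transn_normr_le 1 _ e (bmfB bg bh) gh x.
  by rewrite transnB.
Qed.

Lemma ba_int_iter_markov k mu f : bmf f ->
  ba_int (iter k (markov_op p) mu) f = ba_int mu (transn k f).
Proof.
elim: k mu f => // k IH mu f bf.
by rewrite iterSr IH// ba_int_markov_op//; exact: bmf_transn.
Qed.

Lemma iter_markovE k mu E : measurable E ->
  iter k (markov_op p) mu E = ba_int mu (transn k \1_E).
Proof.
by move=> mE; rewrite -ba_int_indic// ba_int_iter_markov//; exact: bmf_indic.
Qed.

Lemma invariant_transn k mu f : M_ba p mu -> bmf f ->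
  ba_int mu (transn k f) = ba_int mu f.
Proof.
move=> Mmu bf; rewrite -ba_int_iter_markov//; congr (ba_int _ _).
by elim: k => //= k ->.
Qed.

End transition_operator.

(** * Invariant measures as ultralimits of Cesaro averages *)

Section ultralimits.
Context {d : measure_display} {X : measurableType d} {R : realType}.
Variable p : R.-pker X ~> X.
Implicit Types (f g : X -> R) (E : set X) (mu nu : ba X R).

Lemma ultrafilter_fmap (S T : Type) (u : S -> T) (U : set_system S) :
  UltraFilter U -> UltraFilter (u @ U).
Proof.
move=> UU; have PU : ProperFilter U by exact: ultra_proper.
split; first exact: fmap_proper_filter.
move=> G GF UG; apply/seteqP; split => // A GA.
have [//|UnA] := in_ultra_setVsetC (u @^-1` A) UU.
have GnA : G (~` A) by exact: UG.
by have := filter_ex (filterI GA GnA) => -[x []].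
Qed.

Lemma ultrafilter_cvg (S : Type) (u : S -> R) (U : set_system S) (M : R) :
  UltraFilter U -> (forall i, `|u i| <= M) -> cvg (u @ U).
Proof.
move=> UU uM; have PU : ProperFilter U by exact: ultra_proper.
have := @segment_compact R (- M) M; rewrite compact_ultra => C.
have [|l [_ ul]] := C _ (ultrafilter_fmap u UU).
  apply: (@filterE _ U) => i /=; rewrite in_itv/=; have := uM i.
  by rewrite ler_norml.
by apply/cvg_ex; exists l.
Qed.

(** The averages start at one step, as in condition (D~); for [N = 0] the value is 0. *)
Definition cesaro N f : X -> R :=
  fun x => N%:R^-1 * \sum_(k < N) transn p k.+1 f x.

Lemma cesaroD N f g x : bmf f -> bmf g ->
  cesaro N (fun x => f x + g x) x = cesaro N f x + cesaro N g x.
Proof.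
move=> bf bg; rewrite /cesaro -mulrDr -big_split; congr (_ * _).
by apply: eq_bigr => k _; rewrite transnD.
Qed.

Lemma cesaroZ N (a : R) f x : bmf f ->
  cesaro N (fun x => a * f x) x = a * cesaro N f x.
Proof.
move=> bf; rewrite /cesaro mulrCA; congr (_ * _); rewrite mulr_sumr.
by apply: eq_bigr => k _; rewrite transnZ.
Qed.

Lemma cesaro_cst N (c : R) x : (0 < N)%N -> cesaro N (fun=> c) x = c.
Proof.
move=> N0; rewrite /cesaro (eq_bigr (fun=> c)).
  by rewrite sumr_const card_ord -[c *+ N]mulr_natl mulKf// pnatr_eq0 -lt0n.
by move=> k _; rewrite transn_cst.
Qed.

Lemma cesaro_mono N f g x : bmf f -> bmf g -> (forall x, f x <= g x) ->
  cesaro N f x <= cesaro N g x.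
Proof.
move=> bf bg fg; rewrite ler_wpM2l ?invr_ge0//.
by apply: ler_sum => k _; exact: transn_mono.
Qed.

Lemma cesaro_normr_le N f (M : R) x : bmf f -> 0 <= M ->
  (forall x, `|f x| <= M) -> `|cesaro N f x| <= M.
Proof.
move=> bf M0 fM; have [->|N0] := posnP N.
  by rewrite /cesaro big_ord0 mulr0 normr0.
rewrite ler_norml -{1}(cesaro_cst (- M) x N0) -{2}(cesaro_cst M x N0).
by apply/andP; split; apply: cesaro_mono => //; try exact: bmf_cst;
  move=> y; have := fM y; rewrite ler_norml => /andP[].
Qed.

Lemma cesaro_indic_mono N A B x : measurable A -> measurable B -> A `<=` B ->
  cesaro N \1_A x <= cesaro N \1_B x.
Proof.
move=> mA mB AB; rewrite ler_wpM2l ?invr_ge0//.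
by apply: ler_sum => k _; exact: transn_indic_mono.
Qed.

(** Telescoping leaves two terms, so the averages are invariant up to O(1/N). This makes their
    ultralimits invariant. *)
Lemma cesaro_trans N f (M : R) x : bmf f -> (forall x, `|f x| <= M) ->
  `|cesaro N (trans p f) x - cesaro N f x| <= N%:R^-1 * (M + M).
Proof.
move=> bf fM; rewrite /cesaro -mulrBr normrM ger0_norm ?invr_ge0//.
rewrite ler_wpM2l ?invr_ge0// -sumrB.
rewrite (eq_bigr (fun k : 'I_N => transn p k.+2 f x - transn p k.+1 f x)).
  rewrite -(big_mkord xpredT (fun k => transn p k.+2 f x - transn p k.+1 f x)).
  rewrite (telescope_sumr (fun k => transn p k.+1 f x))//.
  by rewrite (le_trans (ler_normB _ _))// lerD// transn_normr_le.
by move=> k _; rewrite /transn -iterSr.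
Qed.

(* The Krylov-Bogolyubov argument with an ultrafilter in place of a
   subsequence: ba has weak-* compact balls. *)
Lemma ultralimit (x_ : nat -> X) (N_ : nat -> nat) :
  (forall j, (j < N_ j)%N) ->
  exists (U : set_system nat) (nu : ba X R),
    [/\ ProperFilter U, \oo `<=` U, Delta_ba p nu
      & forall E, measurable E ->
          cesaro (N_ j) \1_E (x_ j) @[j --> U] --> nu E].
Proof.
move=> jN; have [U [UU ooU]] := ultraFilterLemma eventually_filter.
have PU : ProperFilter U by exact: ultra_proper.
pose c f j := cesaro (N_ j) f (x_ j).
pose L f := lim (c f @ U).
(* Bounded sequences converge along [U], so [L] is a genuine limit for all bounded measurable
   functions at once. *)
have cL f : bmf f -> c f @ U --> L f.
  move=> bf; have [M M0 fM] := bmf_bound bf.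
  apply: (@ultrafilter_cvg _ _ _ M) => // j; exact: cesaro_normr_le.
have LE f l : c f @ U --> l -> L f = l by move=> /cvg_lim; apply.
have LD f g : bmf f -> bmf g -> L (fun x => f x + g x) = L f + L g.
  move=> bf bg; apply: LE.
  rewrite (_ : c _ = fun j => c f j + c g j); first exact: (cvgD (cL _ bf) (cL _ bg)).
  by apply/funext => j; exact: cesaroD.
have LZ (a : R) f : bmf f -> L (fun x => a * f x) = a * L f.
  move=> bf; apply: LE.
  rewrite (_ : c _ = fun j => a * c f j); first exact: (cvgZl_tmp (cL _ bf)).
  by apply/funext => j; exact: cesaroZ.
have LM f M : bmf f -> 0 <= M -> (forall x, `|f x| <= M) -> `|L f| <= M.
  move=> bf M0 fM; apply: (closed_cvg _ (@closed_le R M) _ _ (cvg_norm (cL _ bf))).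
  by apply: (@filterE _ U) => j; exact: cesaro_normr_le.
have Lge0 f : bmf f -> (forall x, 0 <= f x) -> 0 <= L f.
  move=> bf f0; apply: (closed_cvg _ (@closed_ge R 0) _ _ (cL _ bf)).
  apply: (@filterE _ U) => j /=; have Nj0 : (0 < N_ j)%N by exact: leq_trans (jN j).
  rewrite -(cesaro_cst 0 (x_ j) Nj0); apply: cesaro_mono => //.
  exact: bmf_cst.
have LT f : bmf f -> L (trans p f) = L f.
  move=> bf; have [M M0 fM] := bmf_bound bf; apply: LE.
  rewrite (_ : c _ = fun j => c f j + (c (trans p f) j - c f j)); last first.
    by apply/funext => j; rewrite addrC subrK.
  rewrite -[L f]addr0; apply: cvgD; first exact: cL.
  apply/cvgr0Pnorm_le => e e0; apply: ooU.
  (* The added 1 keeps the divisor positive when [M] is 0. *)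
  have M2 : 0 < M + M + 1 by rewrite ltr_wpDl// addr_ge0.
  have /cvgr0Pnorm_le/(_ _ (divr_gt0 e0 M2)) := @cvg_harmonic R.
  apply: filterS => j; rewrite ger0_norm ?harmonic_ge0// => hj.
  apply: (le_trans (cesaro_trans (N_ j) (x_ j) bf fM)).
  apply: (@le_trans _ _ (j.+1%:R^-1 * (M + M + 1))).
    apply: ler_pM; rewrite ?invr_ge0 ?addr_ge0 ?lerDl//.
    by rewrite lef_pV2 ?ler_nat ?posrE ?ltr0n// (leq_trans _ (jN j)).
  by rewrite -ler_pdivlMr.
pose n_ E := if `[< measurable E >] then L \1_E else 0.
have nE E : measurable E -> n_ E = L \1_E by move=> mE; rewrite /n_ asboolT.
have n_ba : n_ \in @ba_pred d X R.
  rewrite inE; split.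
  - move=> A B mA mB AB /=; rewrite -EFinD; congr EFin.
    rewrite !nE//; last exact: measurableU.
    by rewrite indicU_disj// LD//; exact: bmf_indic.
  - exists 1 => E mE; rewrite nE//; apply: LM => //; first exact: bmf_indic.
    by move=> x; rewrite indicE; case: (_ \in _); rewrite ?normr0 ?normr1.
  - by move=> E mE; rewrite /n_ asboolF.
pose nu := Ba n_ba.
have nu0 : 0 <= nu.
  apply/ba_ge0P => E mE; rewrite [nu E]nE//; apply: Lge0; first exact: bmf_indic.
  by move=> x; rewrite indicE.
exists U, nu; split => //; last first.
  by move=> E mE; rewrite [nu E]nE//; exact/cL/bmf_indic.
have Lint f : bmf f -> L f = ba_int nu f.
  apply: (@ba_int_unique _ _ _ L nu 1) => //.
  - by move=> a E mE; rewrite LZ ?[nu E]nE//; exact: bmf_indic.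
  - move=> f1 g e bf bg e0 fg; rewrite mulr1.
    rewrite (_ : L f1 - L g = L (fun x => f1 x - g x)).
      by apply: LM => //; exact: bmfB.
    rewrite LD//; last exact: bmfN.
    congr (_ + _); rewrite -mulN1r -LZ//; congr L.
    by apply/funext => x; rewrite mulN1r.
split; last first.
  apply: ba_ext => E mE; rewrite markov_opE// -Lint; last exact/bmf_trans/bmf_indic.
  by rewrite LT ?[nu E]nE//; exact: bmf_indic.
split => //; rewrite nneg_norm// [nu _]nE//; apply: LE.
rewrite (_ : c _ = fun=> 1); first exact: cvg_cst.
apply/funext => j; rewrite /c (_ : \1__ = fun=> 1); last first.
  by apply/funext => x; rewrite indicT.
by rewrite cesaro_cst//; exact: leq_trans (jN j).
Qed.

End ultralimits.

(** * Setwise limits of countably additive measures *)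

Section setwise_limits.
Context {d : measure_display} {X : measurableType d} {R : realType}.
Implicit Types (E : set X) (mu nu : ba X R).

(** Continuity at the empty set is applied to the tails of a disjoint union, whose measures are the
    defects of the partial sums. *)
Lemma is_ca_continuity mu :
  (forall E : nat -> set X, (forall m, measurable (E m)) ->
    {homo E : i j / (i <= j)%N >-> j `<=` i} -> \bigcap_m E m = set0 ->
    mu (E m) @[m --> \oo] --> 0) ->
  is_ca mu.
Proof.
move=> H; apply/is_caP => F mF tF.
have mU : measurable (\bigcup_n F n) by exact: bigcup_measurable.
pose E n := \bigcup_n F n `\` \bigcup_(i in `I_n) F i.
have mE n : measurable (E n).
  by apply: measurableD => //; exact: bigcup_measurable.
have EE n : \sum_(0 <= i < n) mu (F i) = mu (\bigcup_n F n) - mu (E n).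
  rewrite /E ba_setD//; first last.
  - by apply: bigcup_sub => i _; exact: bigcup_sup.
  - exact: bigcup_measurable.
  - rewrite opprB addrC subrK bigcup_mkord -(big_mkord xpredT F).
    rewrite ba_big ?iota_uniq//.
    by move=> i j _ _; move/trivIsetP : tF; exact.
under eq_fun do rewrite EE.
suff E0 : mu (E n) @[n --> \oo] --> 0.
  have := cvgB (cvg_cst (mu (\bigcup_n F n))) E0; rewrite subr0; exact.
apply: H => //.
- move=> i j ij; apply: setDS => x [k/= ki Fkx].
  by exists k => //=; exact: leq_trans ki ij.
- apply/seteqP; split => // x Ex; have [k _ Fkx] := (Ex 0%N I).1.
  by have [_] := Ex k.+1 I; apply; exists k => /=.
Qed.

(* A special case of Nikodym's convergence theorem.  Were the limit not
   continuous at the empty set along E, a gliding hump would produce a set F,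
   made of every other difference E_(s j) - E_(s (j + 1)), along which q N F
   does not converge. *)
Lemma setwise_limit_ca mu (q : nat -> set X -> R) : 0 <= mu ->
  (forall N E, measurable E -> 0 <= q N E) ->
  (forall N A B, measurable A -> measurable B -> A `&` B = set0 ->
    q N (A `|` B) = q N A + q N B) ->
  (forall N (E : nat -> set X), (forall m, measurable (E m)) ->
    {homo E : i j / (i <= j)%N >-> j `<=` i} -> \bigcap_m E m = set0 ->
    q N (E m) @[m --> \oo] --> 0) ->
  (forall E, measurable E -> q N E @[N --> \oo] --> mu E) ->
  is_ca mu.
Proof.
move=> mu0 q0 qD qc qmu; apply: is_ca_continuity => E mE dE E0.
have qB N A B : measurable A -> measurable B -> B `<=` A ->
    q N (A `\` B) = q N A - q N B.
  move=> mA mB BA; rewrite -{2}(setDUK BA) qD ?setDIK//; last exact: measurableD.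
  by ring.
have qle N A B : measurable A -> measurable B -> A `<=` B -> q N A <= q N B.
  move=> mA mB AB; rewrite -subr_ge0 -qB//; apply: q0; exact: measurableD.
have muE i j : (i <= j)%N -> mu (E j) <= mu (E i).
  by move=> ij; apply: ba_mono => //; exact: dE.
apply/cvgr0Pnorm_le => e e0; apply: contrapT => noe.
have emu m : e < mu (E m).
  rewrite ltNge; apply/negP => me; apply: noe; exists m => // k /= mk.
  by rewrite ger0_norm ?ba_nneg// (le_trans (muE _ _ mk)).
pose D := inf (range (mu \o E)).
have Dlb : has_lbound (range (mu \o E)) by exists e => _ [m _ <-] /=; exact: ltW.
have Dmu m : D <= mu (E m) by apply: ge_inf => //; exists m.
have D0 : 0 < D.
  apply: (lt_le_trans e0); apply: lb_le_inf; first by exists (mu (E 0%N)), 0%N.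
  by move=> _ [m _ <-] /=; exact: ltW.
(* In the end [q] is at least D - 2h = 6h on [F] at even stages and at most 4h at odd ones, while a
   limit within h/2 of both allows a gap of h only. *)
pose h := D / 8; have h0 : 0 < h by rewrite divr_gt0.
(* From [m0] on, [mu (E m)] lies between D and D + h, so the differences of these sets carry at most
   h. *)
have [_ [m0 _ <-] /= m0D] : exists2 r, range (mu \o E) r & r < D + h.
  apply: inf_adherent => //; split => //.
  by exists (mu (E 0%N)), 0%N.
(* [s.1] is an index at which [q] is close to [mu] on [E m] and on [E m0]; [s.2] is the index of a
   later set that this [q] hardly charges. *)
have step m : exists s : nat * nat, [/\ (m <= s.1)%N, (m < s.2)%N,
    `|mu (E m) - q s.1 (E m)| <= h, `|mu (E m0) - q s.1 (E m0)| <= h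
    & q s.1 (E s.2) <= h].
  have /cvgrPdist_le/(_ _ h0)[N1 _ hN1] := qmu _ (mE m).
  have /cvgrPdist_le/(_ _ h0)[N2 _ hN2] := qmu _ (mE m0).
  pose N := (m + N1 + N2)%N.
  have /cvgr0Pnorm_le/(_ _ h0)[M _ hM] := qc N E mE dE E0.
  exists (N, (m + M).+1); split => /=.
  - by rewrite /N; lia.
  - lia.
  - by apply: hN1 => /=; rewrite /N; lia.
  - by apply: hN2 => /=; rewrite /N; lia.
  - by rewrite (le_trans (ler_norm _))// hM//=; lia.
have [s sP] := choice step.
pose t j := iter j (fun m => (s m).2) m0.
have tS j : t j.+1 = (s (t j)).2 by [].
have tlt j : (t j < t j.+1)%N by rewrite tS; have [] := sP (t j).
have tmono i j : (i <= j)%N -> (t i <= t j)%N.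
  elim: j => [|j IH]; first by rewrite leqn0 => /eqP ->.
  rewrite leq_eqVlt => /predU1P[->//|]; rewrite ltnS => /IH ij.
  exact: leq_trans ij (ltnW (tlt j)).
have tge j : (j <= t j)%N.
  by elim: j => // j IH; apply: leq_ltn_trans IH (tlt j).
pose F := \bigcup_(j in [set j | ~~ odd j]) (E (t j) `\` E (t j.+1)).
have mF : measurable F by apply: bigcup_measurable => j _; exact: measurableD.
(* At an even stage [F] contains the current difference, of mass at least (D - h) - h. *)
have Feven j : ~~ odd j -> D - 2 * h <= q (s (t j)).1 F.
  move=> ej; have [_ _ h1 _ h3] := sP (t j).
  apply: (@le_trans _ _ (q (s (t j)).1 (E (t j) `\` E (t j.+1)))).
    rewrite qB//; last exact: dE (ltnW (tlt j)).
    by rewrite tS; move: h1; rewrite ler_norml => /andP[_]; have := Dmu (t j); lra.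
  by apply: qle => //; [exact: measurableD|exact: (bigcup_sup (i := j))].
(* At an odd stage the earlier differences lie in [E m0] minus [E (t j)], of mass at most 3h, and
   the later ones in [E (t j.+1)], of mass at most h. *)
have Fodd j : odd j -> q (s (t j)).1 F <= 4 * h.
  move=> oj; have [_ _ h1 h2 h3] := sP (t j).
  have mD : measurable (E m0 `\` E (t j)) by exact: measurableD.
  apply: (@le_trans _ _ (q (s (t j)).1 ((E m0 `\` E (t j)) `|` E (t j.+1)))).
    apply: qle => //; first exact: measurableU.
    move=> x [i /= ei [Eix nEx]]; have [ij|ji|eij] := ltngtP i j.
    - left; split; first exact: dE (tmono 0%N i (leq0n i)) _ Eix.
      by move=> Ejx; apply: nEx; exact: dE (tmono _ _ ij) _ Ejx.
    - by right; exact: dE (tmono _ _ ji) _ Eix.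
    - by move: oj ei; rewrite eij => ->.
  rewrite qD//.
    rewrite qB//; last exact: dE (tmono 0%N j (leq0n j)).
    rewrite tS; move: h1 h2; rewrite !ler_norml => /andP[h11 h12] /andP[h21 h22].
    by have := Dmu (t j); lra.
  apply/seteqP; split => // x [[_ nEx] Ex]; apply: nEx.
  exact: dE (ltnW (tlt j)) _ Ex.
have h20 : 0 < h / 2 by rewrite divr_gt0.
have /cvgrPdist_le/(_ _ h20)[N _ hN] := qmu _ mF.
have sN j : (N <= j)%N -> `|mu F - q (s (t j)).1 F| <= h / 2.
  move=> Nj; apply: hN => /=; have [+ _ _ _ _] := sP (t j).
  by have := tge j; lia.
have e2N : ~~ odd N.*2 by rewrite odd_double.
have o2N : odd N.*2.+1 by rewrite /= odd_double.
have /sN : (N <= N.*2)%N by lia.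
have /sN : (N <= N.*2.+1)%N by lia.
have := Feven _ e2N; have := Fodd _ o2N.
move: D0 (q _ F) (q _ F) (mu F); rewrite /h; move: (D); clear.
move=> D D0 a b m a4 b2; rewrite !ler_norml => /andP[a1 a2] /andP[b1 b3].
lra.
Qed.

End setwise_limits.

(** * Countable additivity of the basis measures *)

Section singular_basis.
Context {d : measure_display} {X : measurableType d} {R : realType}.
Variable p : R.-pker X ~> X.
Implicit Types (f g : X -> R) (E K : set X) (mu nu : ba X R).

Lemma ba_sum_scaleE (I : Type) (r : seq I) (c : I -> R) (H : I -> ba X R) E :
  (\sum_(i <- r) c i *: H i) E = \sum_(i <- r) c i * H i E.
Proof.
elim: r => [|i r IH]; first by rewrite !big_nil ba_0E.
by rewrite !big_cons ba_addE ba_scaleE IH.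
Qed.

Lemma S_baT mu : S_ba mu -> mu setT = 1.
Proof. by move=> [mu0 mu1]; rewrite -nneg_norm. Qed.

Lemma S_ba_le1 mu E : S_ba mu -> measurable E -> mu E <= 1.
Proof. by move=> Smu mE; rewrite -(S_baT Smu); apply: ba_mono => //; exact: Smu.1. Qed.

Lemma ba_bigcap_full mu (I : Type) (r : seq I) (P : pred I) (D : I -> set X) :
  S_ba mu -> (forall i, measurable (D i)) -> (forall i, P i -> mu (D i) = 1) ->
  mu (\big[setI/setT]_(i <- r | P i) D i) = 1.
Proof.
move=> Smu mD D1; have mu0 := Smu.1; elim: r => [|i r IH].
  by rewrite big_nil S_baT.
rewrite big_cons; case: ifPn => // /D1 Di1.
set B := \big[setI/setT]_(i <- r | P i) D i in IH *.
have mB : measurable B by apply: big_ind => //; exact: measurableI.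
apply/eqP; rewrite eq_le S_ba_le1//=; last exact: measurableI.
have := ba_setC mu (measurableI _ _ (mD i) mB); rewrite setCI S_baT//.
have := ba_le_setU mu0 (measurableC (mD i)) (measurableC mB).
rewrite !ba_setC// S_baT// Di1 IH subrr addr0 => h1 h2.
by rewrite -subr_ge0 -[X in _ <= X]opprK opprB -h2 oppr_ge0.
Qed.

(** The sets separating [H i] from each other basis measure are intersected. Condition (alpha)
    shrinks the intersection to a closed set of full [H i] measure, which remains null for the
    others. *)
Lemma singular_closed_supports n (H : 'I_n -> ba X R) :
  disjoint_basis p H -> condition_alpha p -> condition_beta H ->
  exists K : 'I_n -> set X, forall i, [/\ measurable (K i), H i (K i) = 1,
    forall j, j != i -> H j (K i) = 0 & stochastically_closed p (K i)].
Proof.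
move=> [_ DH _] alpha beta.
have HT i : H i setT = 1 by exact: S_baT (DH i).1.
have H0 i : 0 <= H i by exact: (DH i).1.1.
suff : forall i, exists K, [/\ measurable K, H i K = 1,
    forall j, j != i -> H j K = 0 & stochastically_closed p K].
  by move=> /choice[K KP]; exists K.
move=> i; have : forall j, exists D, measurable D /\
    (j != i -> H i D = 1 /\ H j D = 0).
  move=> j; have [->|ji] := eqVneq j i; first by exists setT.
  have ij : i != j by rewrite eq_sym.
  have [D1 [D2 [mD1 mD2 D12 HD1 HD2]]] := beta i j ij.
  exists D1; split => // _; rewrite HD1 HT; split => //.
  apply/eqP; rewrite eq_le ba_nneg// andbT.
  rewrite (@le_trans _ _ (H j (~` D2)))//.
    by apply: ba_mono => //; [exact: measurableC|exact/disjoints_subset].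
  by rewrite ba_setC// HD2 subrr.
move=> /choice[D DP].
pose B := \big[setI/setT]_(j <- enum 'I_n | j != i) D j.
have mB : measurable B.
  by apply: big_ind => // [|j _]; [exact: measurableI|exact: (DP j).1].
have HB : H i B = 1.
  apply: ba_bigcap_full; [exact: (DH i).1|by move=> j; exact: (DP j).1|].
  by move=> j ji; exact: ((DP j).2 ji).1.
have [K [KB mK HK cK]] := alpha (H i) (DH i) B mB HB.
exists K; split => // j ji; apply/eqP; rewrite eq_le ba_nneg// andbT.
rewrite -((DP j).2 ji).2; apply: ba_mono => //; first exact: (DP j).1.
move=> x /KB; rewrite /B (big_rem j) ?mem_enum//= ji => -[+ _]; exact.
Qed.

(** Closedness says that 1_K <= T 1_K, so the iterates of T on 1_K increase. *)
Lemma transn_closed K k x : measurable K -> stochastically_closed p K -> K x ->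
  transn p k \1_K x = 1.
Proof.
move=> mK cK Kx; apply/eqP; rewrite eq_le transn_indic_le1//=.
suff h : \1_K x <= transn p k \1_K x.
  by move: h; rewrite indicE mem_set.
elim: k => // k IH; rewrite /transn iterSr; apply: (le_trans IH).
apply: transn_mono; [exact: bmf_indic|exact/bmf_trans/bmf_indic|].
move=> y; rewrite trans_indic// indicE; case: (boolP (y \in K)) => [/set_mem Ky|_].
  by rewrite cK.
by rewrite fine_ge0.
Qed.

Lemma trans_cvg0 (f : nat -> X -> R) (M : R) : (forall m, bmf (f m)) ->
  (forall m x, `|f m x| <= M) -> (forall x, f m x @[m --> \oo] --> 0) ->
  forall x, trans p (f m) x @[m --> \oo] --> 0.
Proof.
move=> bf fM f0 x.
have [] := @dominated_convergence _ _ _ (p x) setT measurableT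
  (fun m => EFin \o f m) (cst 0%E) (cst M%:E).
- by move=> m; apply/measurable_EFinP; exact: (bf m).1.
- exact: measurable_cst.
- by apply: aeW => y _; apply/fine_cvgP; split; [exact: nearW|exact: f0].
- exact: (bmf_integrable p x (bmf_cst M)).
- by apply: aeW => y m _ /=; rewrite lee_fin.
move=> _ _; rewrite integral0 => h.
rewrite (_ : (fun _ => _) = fine \o (fun m => (\int[p x]_y (EFin \o f m) y)%E))//.
by have /fine_cvgP[] := h.
Qed.

Lemma cesaro_cvg0 N (E : nat -> set X) x : (forall m, measurable (E m)) ->
  {homo E : i j / (i <= j)%N >-> j `<=` i} -> \bigcap_m E m = set0 ->
  cesaro p N \1_(E m) x @[m --> \oo] --> 0.
Proof.
move=> mE dE E0.
suff : cesaro p N \1_(E m) x @[m --> \oo] --> N%:R^-1 * \sum_(k < N) (0 : R).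
  by rewrite big1// mulr0.
apply: cvgZl_tmp; apply: (@cvg_big R _ +%R 0 xpredT (@add_continuous _)) => k _.
(* The induction runs over all exponents from 0, where the indicator at [x] is eventually 0; each
   further step is dominated convergence. *)
move: {k}(k.+1 : nat) x; elim => [|k IH] x; last first.
  apply: (@trans_cvg0 _ 1) => // m; first exact/bmf_transn/bmf_indic.
  by move=> y; rewrite ger0_norm ?transn_indic_ge0// transn_indic_le1.
have [m nEm] : exists m, ~ E m x.
  apply: contrapT => nex; suff : set0 x by []; rewrite -E0 => m _.
  by apply: contrapT => nEm; apply: nex; exists m.
apply: cvg_near_cst; exists m => // j /= mj; rewrite /transn/= indicE memNset//.
by move=> Ej; apply: nEm; exact: dE mj _ Ej.
Qed.

(** Evaluation at [K i] kills every basis measure but [H i] and so reads off the [i]-th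
    coefficient. *)
Lemma invariant_decomposition n (H : 'I_n -> ba X R) (K : 'I_n -> set X) nu :
  is_basis H (M_ba p) -> (forall i, H i (K i) = 1) ->
  (forall i j, j != i -> H j (K i) = 0) -> M_ba p nu ->
  nu = \sum_(i < n) nu (K i) *: H i.
Proof.
move=> [_ _ HM] H1 H0 /HM[c ->]; apply: eq_bigr => i _; congr (_ *: _).
rewrite ba_sum_scaleE (bigD1 i)//= H1 mulr1 big1 ?addr0// => j ji.
by rewrite H0 ?mulr0.
Qed.

(** Were convergence to fail, an ultralimit along the bad times would be an invariant probability of
    mass 1 on [K i], hence [H i] itself, while its approximants stay away from [H i E]. *)
Lemma cesaro_closed_cvg n (H : 'I_n -> ba X R) (K : 'I_n -> set X) i x E :
  disjoint_basis p H ->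
  (forall i, [/\ measurable (K i), H i (K i) = 1,
    forall j, j != i -> H j (K i) = 0 & stochastically_closed p (K i)]) ->
  K i x -> measurable E -> cesaro p N \1_E x @[N --> \oo] --> H i E.
Proof.
move=> [HM DH _] KP Kx mE; apply/cvgrPdist_le => e e0; apply: contrapT => bad.
have : forall j, exists N, (j < N)%N /\ e < `|H i E - cesaro p N \1_E x|.
  move=> j; apply: contrapT => nex; apply: bad; exists j.+1 => // N /= jN.
  by rewrite leNgt; apply/negP => eN; apply: nex; exists N.
move=> /choice[N_ N_P].
have [|U [nu [PU ooU [[nu0 nu1] Mnu] cnu]]] := @ultralimit _ _ _ p (fun=> x) N_.
  by move=> j; exact: (N_P j).1.
have [mK HK _ cK] := KP i.
have nuK : nu (K i) = 1.
  have := cnu _ mK; rewrite (_ : (fun _ => _) = fun=> 1).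
    by move/cvg_lim => <-//; rewrite lim_cst.
  apply/funext => j; rewrite -[RHS](@cesaro_cst _ _ _ p (N_ j) 1 x); last first.
    exact: leq_trans (N_P j).1.
  rewrite /cesaro; congr (_ * _); apply: eq_bigr => k _.
  by rewrite transn_cst transn_closed.
have nuE : nu = \sum_(j < n) nu (K j) *: H j.
  apply: invariant_decomposition => // [j|j k]; first by have [] := KP j.
  by have [_ _ + _] := KP j; apply.
have nuT : nu setT = 1 by exact: S_baT.
have nuHi : nu = H i.
  rewrite nuE (bigD1 i)//= nuK scale1r big1 ?addr0// => j ji.
  (* The term of [H i] already exhausts the total mass 1, and the other coefficients are
     nonnegative. *)
  suff -> : nu (K j) = 0 by rewrite scale0r.
  move: nuT; rewrite {1}nuE ba_sum_scaleE (bigD1 i)//= nuK.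
  rewrite (S_baT (DH i).1) mulr1 => /eqP; rewrite -subr_eq0 addrAC subrr add0r.
  rewrite psumr_eq0 => [|k _]; last first.
    by rewrite mulr_ge0// ba_nneg//; exact: (DH k).1.1.
  move=> /allP/(_ j); rewrite mem_index_enum => /(_ isT)/implyP/(_ ji)/eqP.
  by rewrite (S_baT (DH j).1) mulr1.
have := cnu _ mE; rewrite nuHi => /cvgrPdist_le/(_ _ e0).
by move=> /filter_ex[j]; rewrite leNgt (N_P j).2.
Qed.

(** From a fixed point of [K i], nonempty because it carries [H i], the averages converge setwise to
    [H i]. *)
Lemma singular_basis_ca n (H : 'I_n -> ba X R) :
  disjoint_basis p H -> condition_alpha p -> condition_beta H ->
  forall i, is_ca (H i).
Proof.
move=> dH alpha beta i.
have [K KP] := singular_closed_supports dH alpha beta.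
have [mK HK _ cK] := KP i; have [_ DH _] := dH.
have [x Kx] : K i !=set0.
  apply/set0P/eqP => K0; move: HK; rewrite K0 ba_set0 => /eqP.
  by rewrite eq_sym oner_eq0.
apply: (@setwise_limit_ca _ _ _ (H i) (fun N E => cesaro p N \1_E x)).
- exact: (DH i).1.1.
- move=> N E mE; rewrite mulr_ge0 ?invr_ge0// sumr_ge0// => k _.
  exact: transn_indic_ge0.
- by move=> N A B mA mB AB; rewrite indicU_disj// cesaroD//; exact: bmf_indic.
- by move=> N E; exact: cesaro_cvg0.
- by move=> E; exact: cesaro_closed_cvg dH KP Kx.
Qed.

Lemma is_ca_sum (I : Type) (r : seq I) (c : I -> R) (H : I -> ba X R) :
  (forall i, is_ca (H i)) -> is_ca (\sum_(i <- r) c i *: H i).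
Proof.
have [c0 cD] := ca_submod_closed X R; move=> caH; elim: r => [|i r IH].
  by rewrite big_nil; move: c0; rewrite inE.
rewrite big_cons; have := cD (c i) (H i) (\sum_(i <- r) c i *: H i).
by rewrite !inE; apply.
Qed.

End singular_basis.

(** * The Doeblin conditions *)

Section uniform_integrability.
Context {d : measure_display} {X : measurableType d} {R : realType}.
Variable p : R.-pker X ~> X.
Implicit Types (f g : X -> R) (E : set X) (mu nu : ba X R).

Lemma ba_bigsetU_le mu (I : Type) (r : seq I) (F : I -> set X) : 0 <= mu ->
  (forall i, measurable (F i)) ->
  mu (\big[setU/set0]_(i <- r) F i) <= \sum_(i <- r) mu (F i).
Proof.
move=> mu0 mF; elim: r => [|i r IH]; first by rewrite !big_nil ba_set0.
rewrite !big_cons (le_trans (ba_le_setU mu0 _ _))//; last by rewrite lerD2l.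
exact: bigsetU_measurable.
Qed.

Lemma ca_bigcup_le mu (F : nat -> set X) (M : R) : 0 <= mu -> is_ca mu ->
  (forall i, measurable (F i)) -> (forall n, \sum_(i < n) mu (F i) <= M) ->
  mu (\bigcup_i F i) <= M.
Proof.
move=> mu0 /is_caP ca mF FM; rewrite seqDU_bigcup_eq.
have mD i : measurable (seqDU F i).
  by apply: measurableD => //; exact: bigsetU_measurable.
apply: (closed_cvg _ (@closed_le R M) _ _ (ca _ mD (@trivIset_seqDU _ F))).
apply: nearW => n /=; rewrite big_mkord (le_trans _ (FM n))//.
by apply: ler_sum => i _; apply: ba_mono => //; exact: subDsetl.
Qed.

(** To be instantiated with the mean of the basis measures and with their number. *)
Variables (phi : ba X R) (C : R).
Hypotheses (Dphi : Delta_ba p phi) (caphi : is_ca phi)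
  (phiC : forall nu, Delta_ba p nu -> forall E, measurable E ->
    nu E <= C * phi E).

Let phi0 : 0 <= phi. Proof. exact: Dphi.1.1. Qed.

(** Otherwise there are, for each j, a set of phi-measure below 2^-(j+1) and a starting point that
    violate the bound at time j + 1. Every tail union contains all late sets, so an ultralimit nu
    gives it mass at least eta; but nu <= C phi, and phi of the tail unions tends to 0. *)
Lemma cesaro_uniform_small (eta : R) : 0 < eta -> exists (m : nat) (delta : R),
  [/\ (0 < m)%N, 0 < delta & forall E, measurable E -> phi E < delta ->
    forall x, cesaro p m \1_E x <= eta].
Proof.
move=> eta0; apply: contrapT => bad.
have : forall j : nat, exists z : set X * X, [/\ measurable z.1,
    phi z.1 < 2^-1 ^+ j.+1 & eta < cesaro p j.+1 \1_(z.1) z.2].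
  move=> j; apply: contrapT => nex; apply: bad; exists j.+1, (2^-1 ^+ j.+1).
  split => // E mE phiE x; rewrite leNgt; apply/negP => lt; apply: nex.
  by exists (E, x).
move=> /choice[z zP].
have [//|U [nu [PU ooU Dnu cnu]]] := @ultralimit _ _ _ p (fun j => (z j).2) S.
pose F J := \bigcup_i (z (i + J)%N).1.
have mz i : measurable (z i).1 by have [] := zP i.
have mF J : measurable (F J) by exact: bigcup_measurable.
have phiF J : phi (F J) <= 2^-1 ^+ J.
  apply: ca_bigcup_le => // n.
  (* The subtracted term makes the geometric bound inductive. *)
  suff : \sum_(i < n) phi (z (i + J)%N).1 <= 2^-1 ^+ J - 2^-1 ^+ (n + J).
    by move=> /le_trans; apply; rewrite gerBl exprn_ge0// invr_ge0.
  elim: n => [|n IH]; first by rewrite big_ord0 add0n subrr.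
  rewrite big_ord_recr/= addSn; have [_ h _] := zP (n + J)%N.
  rewrite (le_trans (lerD IH (ltW h)))// exprS.
  by move: (2^-1 ^+ (n + J)) => a; lra.
have etaF J : eta <= C * 2^-1 ^+ J.
  have C0 : 0 <= C.
    by have := phiC Dphi measurableT; rewrite (S_baT Dphi.1) mulr1; exact: le_trans.
  apply: (@le_trans _ _ (C * phi (F J))); last by rewrite ler_wpM2l.
  apply: (le_trans _ (phiC Dnu (mF J))).
  apply: (closed_cvg _ (@closed_ge R eta) _ _ (cnu _ (mF J))).
  apply: ooU; exists J => // j /= Jj; have [mzj _ lt] := zP j.
  rewrite (le_trans (ltW lt))//; apply: cesaro_indic_mono => // x zx.
  by exists (j - J)%N => //; rewrite subnK.
have [n Cn] : exists n : nat, C / eta < n%:R.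
  exists (Num.bound `|C / eta|).
  exact: le_lt_trans (ler_norm _) (archi_boundP (normr_ge0 _)).
have := etaF n; rewrite leNgt => /negP; apply.
rewrite exprVn ltr_pdivrMr ?exprn_gt0//.
rewrite ltr_pdivrMr// in Cn; rewrite (lt_le_trans Cn)// mulrC ler_wpM2l ?(ltW eta0)//.
by rewrite -natrX ler_nat ltnW// ltn_expl.
Qed.

(* If p^m(x, E) > eta, then for each k <= m the k-step distribution from x gives
   mass at least eta / 2 to the set where p^(m - k)(., E) > eta / 2, and these
   m sets are phi-small by Markov's inequality, as phi is invariant. *)
Lemma transn_uniform_small (eta : R) : 0 < eta -> exists (m : nat) (delta : R),
  [/\ (0 < m)%N, 0 < delta & forall E, measurable E -> phi E <= delta ->
    forall x, transn p m \1_E x <= eta].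
Proof.
move=> eta0; have e40 : 0 < eta / 4 by rewrite divr_gt0.
have [m [delta [m0 delta0 H]]] := cesaro_uniform_small e40.
have mR0 : 0 < m%:R :> R by rewrite ltr0n.
(* By Markov's inequality each of the [m] sets has measure at most 2 phi(E) / eta, so that their
   union has at most delta / 2. *)
have del0 : 0 < delta * eta / 4 / m%:R.
  by rewrite divr_gt0// divr_gt0// mulr_gt0.
exists m, (delta * eta / 4 / m%:R); split => // E mE phiE x.
rewrite leNgt; apply/negP => lt.
pose g k := transn p (m - k.+1) \1_E.
have bg k : bmf (g k) by exact/bmf_transn/bmf_indic.
pose G := \big[setU/set0]_(k < m) [set y | eta / 2 < g k y].
have mg k : measurable [set y | eta / 2 < g k y] by exact: bmf_gt_measurable.
have mG : measurable G by exact: bigsetU_measurable.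
have phiG : phi G < delta.
  apply: (@le_lt_trans _ _ (\sum_(k < m) (2 / eta) * phi E)).
    apply: (le_trans (ba_bigsetU_le _ phi0 _)) => //; apply: ler_sum => k _.
    have := ba_markov phi0 (bg k) (fun y => transn_indic_ge0 _ _ y mE) (mg k).
    rewrite invariant_transn ?ba_int_indic//; [|exact: Dphi.2|exact: bmf_indic].
    by rewrite -ler_pdivlMl ?divr_gt0// invf_div.
  rewrite sumr_const card_ord -[ltLHS]mulr_natl.
  rewrite ler_pdivlMr// mulrC in phiE.
  rewrite mulrCA -ltr_pdivlMl ?divr_gt0// invf_div.
  rewrite (le_lt_trans phiE)// -subr_gt0.
  rewrite (_ : _ - _ = delta * eta / 4); last by field.
  by rewrite divr_gt0// mulr_gt0.
have := H G mG phiG x; rewrite leNgt => /negP; apply.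
(* Every term of the average is at least eta / 2, against the bound eta / 4 of [H]. *)
apply: (@lt_le_trans _ _ (eta / 2)); first by lra.
rewrite -[leLHS](mulKf (lt0r_neq0 mR0)) ler_wpM2l ?invr_ge0//.
rewrite mulr_natl -[in leLHS](card_ord m) -sumr_const; apply: ler_sum => k _.
have E1 : transn p m \1_E = transn p k.+1 (g k).
  by rewrite /g -transn_add subnKC.
have bG : bmf (fun y => \1_G y + eta / 2).
  by apply: bmfD; [exact: bmf_indic|exact: bmf_cst].
have := @transn_mono _ _ _ p k.+1 (g k) _ (bg k) bG _ x.
rewrite -E1 transnD ?transn_cst; [|exact: bmf_indic|exact: bmf_cst].
move=> h; suff : transn p m \1_E x <= transn p k.+1 \1_G x + eta / 2 by lra.
apply: h => y; rewrite indicE; have [lt2|le2] := ltP (eta / 2) (g k y).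
  rewrite mem_set/=; last first.
    by rewrite /G -bigcup_seq; exists k => //=; rewrite mem_index_enum.
  by rewrite (le_trans (transn_indic_le1 p _ y mE))// lerDl divr_ge0// ltW.
by rewrite (le_trans le2)// lerDr.
Qed.

Lemma Doeblin_condition : condition_D p.
Proof.
have h0 : 0 < 1 / 2 :> R by lra.
have [m [delta [m0 delta0 H]]] := transn_uniform_small h0.
have cap : phi \in @ca_pred d X R by rewrite inE.
(* The minimum keeps eps within the threshold [delta] and ensures 1/2 <= 1 - eps. *)
exists (Ca cap), (Num.min delta (1 / 2)), m; split => //.
  by rewrite lt_min delta0 h0.
move=> E mE; rewrite /= le_min => /andP[phiE _] x.
rewrite kiterE// lee_fin (le_trans (H E mE phiE x))//.
have : Num.min delta (1 / 2) <= 1 / 2 by rewrite ge_min lexx orbT.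
by move: (Num.min _ _) => a; lra.
Qed.

Lemma averaged_Doeblin_condition : condition_Dtilde p.
Proof.
have h0 : 0 < 1 / 2 :> R by lra.
have [m [delta [m0 delta0 H]]] := cesaro_uniform_small h0.
have cap : phi \in @ca_pred d X R by rewrite inE.
exists (Ca cap), (Num.min delta (1 / 2)), m; split => //.
  by rewrite lt_min delta0 h0.
move=> E mE; rewrite /= lt_min => /andP[phiE _] x.
rewrite big_add1/= big_mkord (eq_bigr (fun k : 'I_m => (transn p k.+1 \1_E x)%:E)).
  rewrite sumEFin -EFinM lee_fin (le_trans (H E mE phiE x))//.
  have : Num.min delta (1 / 2) <= 1 / 2 by rewrite ge_min lexx orbT.
  by move: (Num.min _ _) => a; lra.
by move=> k _; rewrite kiterE.
Qed.

End uniform_integrability.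

(** * Weak regularity of bimeasures *)

Section weak_regularity.
Context {R : realFieldType}.

(** The contribution of a cell to the squared L2 norm of the density of the first measure with
    respect to the sum of both. Dividing by [a + b] instead of [b] keeps it at most [a]; it is 0 if
    [a + b] is. *)
Definition energy (a b : R) := a ^+ 2 / (a + b).

(** With t = a + b and w = |a - u t| the bracket is w^2 / t, and w <= xi t + w^2 / (t xi) by the
    arithmetic-geometric inequality. This linear form takes the place of Cauchy-Schwarz. *)
Lemma energy_deviation (a b u xi : R) : 0 <= a -> 0 <= b -> 0 < xi ->
  `|a - u * (a + b)| <=
  xi * (a + b) + (energy a b - 2 * u * a + u ^+ 2 * (a + b)) / xi.
Proof.
move=> a0 b0 xi0; rewrite /energy; set t := a + b.
have [t0|t0] := eqVneq t 0.
  have aE : a = 0 by rewrite /t in t0; lra.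
  by rewrite t0 aE !(mulr0, mul0r, expr0n, subr0, addr0, normr0).
have tp : 0 < t by rewrite lt_def t0 addr_ge0.
set w := `|_|.
have -> : a ^+ 2 / t - 2 * u * a + u ^+ 2 * t = w ^+ 2 / t.
  by rewrite /w real_normK ?num_real//; field.
have w0 : 0 <= w by exact: normr_ge0.
clearbody w t; rewrite -subr_ge0.
have -> : xi * t + w ^+ 2 / t / xi - w =
    ((xi * t - w) ^+ 2 + xi * t * w) / (t * xi).
  by field; rewrite t0 gt_eqF.
by rewrite divr_ge0 ?addr_ge0 ?sqr_ge0 ?mulr_ge0 // ?mulr_ge0 // ltW.
Qed.

(** The pieces [s] refine the cells [i]. With u_i = A_i / (A_i + B_i), the brackets of
    [energy_deviation] sum to the energy gained by refining, at most xi^2; the total deviation is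
    thus at most 2 xi + xi. *)
Lemma energy_defect (I S : finType) (a b : I -> S -> R) (A B : I -> R) (xi L : R) :
  (forall i s, 0 <= a i s) -> (forall i s, 0 <= b i s) -> 0 < xi -> 0 <= L ->
  (forall i, A i = \sum_s a i s) -> (forall i, B i = \sum_s b i s) ->
  \sum_i (A i + B i) <= 2 ->
  \sum_i \sum_s energy (a i s) (b i s) <= \sum_i energy (A i) (B i) + xi ^+ 2 ->
  \sum_(i | A i <= L * B i) \sum_s `|a i s - A i / B i * b i s|
    <= (1 + L) * (3 * xi).
Proof.
move=> a0 b0 xi0 L0 AE BE AB en.
have A0 i : 0 <= A i by rewrite AE sumr_ge0.
have B0 i : 0 <= B i by rewrite BE sumr_ge0.
have L10 : 0 <= 1 + L by rewrite addr_ge0.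
pose u i := A i / (A i + B i).
(* Passing from the density u_i to the ratio A_i / B_i costs the factor (A_i + B_i) / B_i, at most 1
   + L on the selected cells. *)
apply: (@le_trans _ _ (\sum_i (1 + L) * \sum_s `|a i s - u i * (a i s + b i s)|)).
  rewrite [leRHS](bigID (fun i => A i <= L * B i))/= ler_wpDr//.
    by apply: sumr_ge0 => i _; rewrite mulr_ge0// sumr_ge0.
  apply: ler_sum => i ALB; rewrite mulr_sumr; apply: ler_sum => s _.
  have [Bi0|Bi0] := eqVneq (B i) 0.
    have Ai0 : A i = 0 by apply/eqP; rewrite eq_le A0 (le_trans ALB)// Bi0 mulr0.
    have -> : a i s = 0.
      have := AE i; rewrite Ai0 => /esym/eqP; rewrite psumr_eq0//.
      by move=> /allP/(_ s); rewrite mem_index_enum => /(_ isT)/eqP.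
    by rewrite Ai0 !mul0r subr0 normr0 mulr_ge0.
  have Bip : 0 < B i by rewrite lt_def Bi0 B0.
  have ABip : 0 < A i + B i by rewrite ltr_wpDl.
  have -> : a i s - A i / B i * b i s =
      (A i + B i) / B i * (a i s - u i * (a i s + b i s)).
    by rewrite /u; field; rewrite Bi0 gt_eqF.
  rewrite normrM ler_wpM2r// ger0_norm ?divr_ge0 ?(ltW ABip)//.
  by rewrite mulrDl divff// addrC lerD2l ler_pdivrMr.
rewrite -mulr_sumr ler_wpM2l//.
apply: (@le_trans _ _ (\sum_i (xi * (A i + B i) +
   (\sum_s energy (a i s) (b i s) - energy (A i) (B i)) / xi))).
  apply: ler_sum => i _.
  apply: (@le_trans _ _ (\sum_s (xi * (a i s + b i s) + (energy (a i s) (b i s)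
     - 2 * u i * a i s + u i ^+ 2 * (a i s + b i s)) / xi))).
    by apply: ler_sum => s _; exact: energy_deviation.
  rewrite big_split/= -mulr_suml !big_split/= sumrN -!mulr_sumr big_split/= -AE -BE.
  rewrite lerD2l ler_pM2r ?invr_gt0// -addrA lerD2l /energy /u.
  have [AB0|AB0] := eqVneq (A i + B i) 0.
    by rewrite AB0 !invr0 !mulr0 !mul0r oppr0 addr0.
  have -> : - (2 * (A i / (A i + B i)) * A i) + (A i / (A i + B i)) ^+ 2 * (A i + B i)
     = - (A i ^+ 2 / (A i + B i)) by field.
  by [].
rewrite big_split/= -mulr_sumr -mulr_suml sumrB.
have h1 : xi * (\sum_i (A i + B i)) <= xi * 2 by rewrite ler_pM2l.
apply: (le_trans (lerD h1 (lexx _))).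
have h2 : (\sum_i \sum_s energy (a i s) (b i s) - \sum_i energy (A i) (B i)) / xi <= xi.
  by rewrite ler_pdivrMr// -expr2 lerBlDl.
by lra.
Qed.

End weak_regularity.

Section bimeasure_regularity.
Context {d : measure_display} {X : measurableType d} {R : realType}.
Implicit Types (E : set X).

Definition additive_on (m : set X -> R) := forall A B, measurable A ->
  measurable B -> A `&` B = set0 -> m (A `|` B) = m A + m B.

(** A finite measurable partition is encoded as a labelling: cells may be empty, and pairing labels
    gives a common refinement. *)
Definition measurable_fibres (I : finType) (f : X -> I) :=
  forall i, measurable (f @^-1` [set i]).

Lemma measurable_fibres_pred (I : finType) (f : X -> I) (P : pred I) :
  measurable_fibres f -> measurable [set x | P (f x)].
Proof.
move=> mf; rewrite (_ : [set x | _] =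
    \big[setU/set0]_(i <- [seq i <- index_enum I | P i]) (f @^-1` [set i])).
  exact: bigsetU_measurable.
rewrite -bigcup_seq; apply/seteqP; split => x /=.
  by move=> Pfx; exists (f x) => //=; rewrite mem_filter mem_index_enum Pfx.
by move=> [i /=]; rewrite mem_filter => /andP[Pi _] ->.
Qed.

Lemma partition_sum (m : set X -> R) (I : finType) (f : X -> I) (P : pred I) E :
  additive_on m -> measurable_fibres f -> measurable E ->
  m (E `&` [set x | P (f x)]) = \sum_(i | P i) m (E `&` f @^-1` [set i]).
Proof.
move=> mD mf mE.
have m0 : m set0 = 0.
  have := mD set0 set0 measurable0 measurable0 (setI0 _); rewrite setU0.
  by move=> /eqP; rewrite -subr_eq subrr eq_sym => /eqP.
rewrite -big_filter.
rewrite (_ : [set x | P (f x)] =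
    [set x | f x \in [seq i <- index_enum I | P i]]); last first.
  by apply/seteqP; split => x /=; rewrite mem_filter mem_index_enum andbT.
have : uniq [seq i <- index_enum I | P i] by rewrite filter_uniq ?index_enum_uniq.
elim: [seq i <- index_enum I | P i] => [|i r IH] /=.
  move=> _; rewrite big_nil (_ : _ `&` _ = set0) ?m0//.
  by apply/seteqP; split => // x [].
move=> /andP[ir ur]; rewrite big_cons -IH//.
have mr : measurable [set x | f x \in r] by exact: (measurable_fibres_pred (mem r)).
rewrite -mD; [|exact: measurableI..|].
- congr m; rewrite -setIUr; congr (_ `&` _); apply/seteqP; split => x /=.
    by rewrite inE => /predU1P.
  by rewrite inE => /predU1P.
- apply/seteqP; split => // x [[_ /= fi] [_ /=]].
  by rewrite fi (negbTE ir).
Qed.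

Lemma partition_total (m : set X -> R) (I : finType) (f : X -> I) E :
  additive_on m -> measurable_fibres f -> measurable E ->
  m E = \sum_i m (E `&` f @^-1` [set i]).
Proof.
move=> mD mf mE; rewrite -partition_sum//; congr m.
by apply/seteqP; split => x; [split|case].
Qed.

(** In the application [G] is phi(dx) p^m(x, dy) on rectangles. *)
Variables (phi : ba X R) (G : set X -> set X -> R).
Hypotheses (Sphi : S_ba phi)
  (GDl : forall E, measurable E -> additive_on (G^~ E))
  (GDr : forall B, measurable B -> additive_on (G B))
  (G0 : forall B E, measurable B -> measurable E -> 0 <= G B E)
  (GT : forall B, measurable B -> G B setT = phi B).

Let phi0 E : 0 <= phi E. Proof. by apply: ba_nneg; exact: Sphi.1. Qed.

Let phiD : additive_on phi. Proof. by move=> A B; exact: ba_add. Qed.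

Lemma bimeasure_mono A B E F : measurable A -> measurable B -> measurable E ->
  measurable F -> A `<=` B -> E `<=` F -> G A E <= G B F.
Proof.
move=> mA mB mE mF AB EF; apply: (@le_trans _ _ (G B E)).
  rewrite -(setDUK AB) GDl ?setDIK//; last exact: measurableD.
  by rewrite lerDl G0//; exact: measurableD.
rewrite -(setDUK EF) GDr ?setDIK//; last exact: measurableD.
by rewrite lerDl G0//; exact: measurableD.
Qed.

Let bimeasure_le B E : measurable B -> measurable E -> G B E <= phi B.
Proof. by move=> mB mE; rewrite -GT//; exact: bimeasure_mono. Qed.

Let En (I J : finType) (f : X -> I) (g : X -> J) : R :=
  \sum_i \sum_j energy (G (f @^-1` [set i]) (g @^-1` [set j]))
                       (phi (f @^-1` [set i]) * phi (g @^-1` [set j])).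

Lemma grid_total (I J : finType) (f : X -> I) (g : X -> J) :
  measurable_fibres f -> measurable_fibres g ->
  \sum_i \sum_j G (f @^-1` [set i]) (g @^-1` [set j]) = 1.
Proof.
move=> mf mg; rewrite -(S_baT Sphi) -GT//.
rewrite (partition_total (GDl measurableT) mf)//; apply: eq_bigr => i _.
rewrite setTI (partition_total (GDr (mf i)) mg)//.
by apply: eq_bigr => j _; rewrite setTI.
Qed.

Lemma phi_total (I : finType) (f : X -> I) :
  measurable_fibres f -> \sum_i phi (f @^-1` [set i]) = 1.
Proof.
move=> mf; rewrite -(S_baT Sphi) (partition_total phiD mf)//.
by apply: eq_bigr => i _; rewrite setTI.
Qed.

Lemma energy_le1 (I J : finType) (f : X -> I) (g : X -> J) :
  measurable_fibres f -> measurable_fibres g -> En f g <= 1.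
Proof.
move=> mf mg; rewrite -(grid_total mf mg); apply: ler_sum => i _.
apply: ler_sum => j _; rewrite /energy.
set a := G _ _; set b := phi _ * phi _.
have a0 : 0 <= a by exact: G0.
have b0 : 0 <= b by rewrite mulr_ge0.
have [ab0|ab0] := eqVneq (a + b) 0; first by rewrite ab0 invr0 mulr0.
have abp : 0 < a + b by rewrite lt_def ab0 addr_ge0.
by rewrite ler_pdivrMr// mulrDr -expr2 lerDl mulr_ge0.
Qed.

(** Energies are at most 1, so some grid comes within [xi] of their supremum and no refinement gains
    more. This replaces the iterated energy increment. *)
Lemma energy_maximizer (xi : R) : 0 < xi ->
  exists (I J : finType) (f : X -> I) (g : X -> J),
  [/\ measurable_fibres f, measurable_fibres g
    & forall (I' J' : finType) (f' : X -> I') (g' : X -> J'),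
      measurable_fibres f' -> measurable_fibres g' -> En f' g' <= En f g + xi].
Proof.
move=> xi0; pose S := [set r | exists (I J : finType) (f : X -> I) (g : X -> J),
  [/\ measurable_fibres f, measurable_fibres g & r = En f g]].
have mu_ : measurable_fibres (fun _ : X => tt).
  move=> i; rewrite (_ : _ @^-1` _ = setT)//.
  by apply/seteqP; split => // x _ /=; case: i.
have S0 : S !=set0.
  by exists (En (fun=> tt) (fun=> tt)), unit, unit, (fun=> tt), (fun=> tt).
have Sub : has_ubound S by exists 1 => _ [I [J [f [g [mf mg ->]]]]]; exact: energy_le1.
have [_ [I [J [f [g [mf mg ->]]]]] lt] := sup_adherent xi0 (conj S0 Sub).
exists I, J, f, g; split => // I' J' f' g' mf' mg'.
rewrite -lerBlDr; apply: le_trans (ltW lt); rewrite lerB//.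
by apply: ub_le_sup => //; exists I', J', f', g'.
Qed.

(* A bimeasure version of the Frieze-Kannan weak regularity lemma, in the cut
   norm.  The energy is the L2 norm of the conditional density of G with respect
   to G + phi x phi; cells on which G is much larger than phi x phi carry little
   mass by the uniform absolute continuity G_small. *)
Lemma bimeasure_regularity (eta delta : R) : 0 < eta -> 0 < delta ->
  (forall B E, measurable B -> measurable E -> phi E <= delta ->
    G B E <= eta * phi B) ->
  exists (I J : finType) (f : X -> I) (g : X -> J) (r : I -> J -> R),
  [/\ measurable_fibres f, measurable_fibres g, forall i j, 0 <= r i j,
      forall i, \sum_j r i j * phi (g @^-1` [set j]) <= 1
    & forall B E, measurable B -> measurable E ->
      `|G B E - \sum_i \sum_j r i j *
         (phi (B `&` f @^-1` [set i]) * phi (E `&` g @^-1` [set j]))|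
      <= 3 * eta].
Proof.
move=> eta0 delta0 G_small.
(* Cells where G exceeds L times phi x phi are bad; as G has total mass 1, their phi x phi mass is
   at most 1 / L = delta eta. *)
pose L := (delta * eta)^-1; have L0 : 0 < L by rewrite invr_gt0 mulr_gt0.
have L10 : 0 < 1 + L by rewrite addr_gt0.
(* Makes the bound (1 + L) (3 xi) of [energy_defect] equal to eta. *)
pose xi := eta / (3 * (1 + L)).
have xi0 : 0 < xi by rewrite divr_gt0// mulr_gt0.
have [I [J [f [g [mf mg max]]]]] := energy_maximizer (exprn_gt0 2 xi0).
pose Gc i j := G (f @^-1` [set i]) (g @^-1` [set j]).
pose Pc i j := phi (f @^-1` [set i]) * phi (g @^-1` [set j]).
have Gc0 i j : 0 <= Gc i j by exact: G0.
have Pc0 i j : 0 <= Pc i j by rewrite mulr_ge0.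
pose good i j := Gc i j <= L * Pc i j.
exists I, J, f, g, (fun i j => if good i j then Gc i j / Pc i j else 0).
split => //.
- by move=> i j; case: ifP => // _; rewrite divr_ge0.
- move=> i; apply: (@le_trans _ _ (\sum_j Gc i j / phi (f @^-1` [set i]))).
    apply: ler_sum => j _; case: ifP => _; last by rewrite mul0r divr_ge0.
    rewrite /Pc; have [->|gj] := eqVneq (phi (g @^-1` [set j])) 0.
      by rewrite mulr0 divr_ge0.
    by rewrite invfM mulrA mulfVK.
  rewrite -mulr_suml; have -> : \sum_j Gc i j = phi (f @^-1` [set i]).
    rewrite -GT// (partition_total (GDr (mf i)) mg)//.
    by apply: eq_bigr => j _; rewrite setTI.
  have [->|fi] := eqVneq (phi (f @^-1` [set i])) 0; first by rewrite mul0r.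
  by rewrite divff.
move=> B E mB mE.
(* In each row the union of the bad columns either has measure at most delta, and [G_small] applies,
   or exceeds delta, and the row is charged to its bad phi x phi mass divided by delta. Each kind
   sums to at most eta. *)
have bad_le : \sum_i \sum_(j | ~~ good i j) Gc i j <= eta + eta.
  pose D i := [set x | ~~ good i (g x)].
  have DE (m : set X -> R) i : additive_on m ->
      m (D i) = \sum_(j | ~~ good i j) m (g @^-1` [set j]).
    move=> mD; have := partition_sum (fun j => ~~ good i j) mD mg measurableT.
    by rewrite setTI => ->; apply: eq_bigr => j _; rewrite setTI.
  have mD i : measurable (D i).
    exact: (measurable_fibres_pred (fun j => ~~ good i j) mg).
  apply: (@le_trans _ _ (\sum_i (eta * phi (f @^-1` [set i]) +
      delta^-1 * (phi (f @^-1` [set i]) * phi (D i))))).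
    apply: ler_sum => i _; rewrite -(DE (G (f @^-1` [set i])))//; last exact: GDr.
    have [le|lt] := leP (phi (D i)) delta.
      by rewrite ler_wpDr ?G_small// mulr_ge0 ?mulr_ge0 ?invr_ge0// ltW.
    rewrite ler_wpDl ?mulr_ge0 ?(ltW eta0)//.
    rewrite mulrCA (le_trans (bimeasure_le (mf i) (mD i)))//.
    by rewrite ler_peMr// mulrC ler_pdivlMr// mul1r ltW.
  rewrite big_split/= -!mulr_sumr phi_total// mulr1 lerD2l.
  rewrite ler_pdivrMl// -[leRHS]invrK -[leRHS]mul1r -/L ler_pdivlMr//.
  rewrite -(grid_total mf mg) mulr_suml; apply: ler_sum => i _.
  rewrite (DE phi)// mulr_sumr mulr_suml.
  rewrite [leRHS](bigID (good i))/= ler_wpDl//.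
    by apply: sumr_ge0 => j _; exact: Gc0.
  by apply: ler_sum => j; rewrite -ltNge mulrC => /ltW.
(* Membership in [B] and [E] cuts each cell into four pieces; [(true, true)] is its part inside B x
   E. *)
pose f' x := (f x, x \in B); pose g' x := (g x, x \in E).
have fibB (K : finType) (h : X -> K) (C : set X) k s :
    (fun x => (h x, x \in C)) @^-1` [set (k, s)] =
    h @^-1` [set k] `&` (fun x => x \in C) @^-1` [set s].
  by apply/seteqP; split => x /=; [move=> [-> ->]|move=> [-> ->]].
have mbool (C : set X) : measurable C -> measurable_fibres (fun x => x \in C).
  move=> mC [].
    rewrite (_ : _ @^-1` _ = C)//.
    by apply/seteqP; split => x /=; [move=> /set_mem|move=> /mem_set ->].
  rewrite (_ : _ @^-1` _ = ~` C); first exact: measurableC.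
  apply/seteqP; split => x /=; first by move=> /negbT/negP; rewrite inE.
  by move=> nC; apply/negbTE; rewrite notin_setE.
have mf' : measurable_fibres f'.
  by move=> [i s]; rewrite fibB; apply: measurableI => //; exact: mbool.
have mg' : measurable_fibres g'.
  by move=> [j s]; rewrite fibB; apply: measurableI => //; exact: mbool.
pose a (c : I * J) (s : bool * bool) :=
  G (f' @^-1` [set (c.1, s.1)]) (g' @^-1` [set (c.2, s.2)]).
pose b (c : I * J) (s : bool * bool) :=
  phi (f' @^-1` [set (c.1, s.1)]) * phi (g' @^-1` [set (c.2, s.2)]).
have splitB (m : set X -> R) i : additive_on m ->
    m (f @^-1` [set i]) = \sum_s m (f' @^-1` [set (i, s)]).
  move=> mD; rewrite (partition_total mD (mbool B mB))//.
  by apply: eq_bigr => s _; rewrite fibB.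
have splitE (m : set X -> R) j : additive_on m ->
    m (g @^-1` [set j]) = \sum_s m (g' @^-1` [set (j, s)]).
  move=> mD; rewrite (partition_total mD (mbool E mE))//.
  by apply: eq_bigr => s _; rewrite fibB.
have aE c : Gc c.1 c.2 = \sum_s a c s.
  rewrite /Gc (splitB (G^~ _)); last exact: GDl.
  rewrite -(pair_bigA _ (fun s t => a c (s, t)))/=; apply: eq_bigr => s _.
  by rewrite splitE//; exact: GDr.
have bE c : Pc c.1 c.2 = \sum_s b c s.
  rewrite /Pc (splitB phi)// (splitE phi)// mulr_suml.
  rewrite -(pair_bigA _ (fun s t => b c (s, t)))/=; apply: eq_bigr => s _.
  by rewrite mulr_sumr.
have tot : \sum_c (Gc c.1 c.2 + Pc c.1 c.2) <= 2.
  rewrite big_split/= -(pair_bigA _ Gc)/= grid_total// -(pair_bigA _ Pc)/=.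
  rewrite (eq_bigr (fun i => phi (f @^-1` [set i]))); first by rewrite phi_total.
  by move=> i _; rewrite -mulr_sumr phi_total// mulr1.
have EnE : En f' g' = \sum_c \sum_s energy (a c s) (b c s).
  rewrite /En pair_bigA [RHS]pair_bigA/=.
  rewrite (reindex (fun z : (I * J) * (bool * bool) =>
    ((z.1.1, z.2.1), (z.1.2, z.2.2))))//=.
  exists (fun z : (I * bool) * (J * bool) => ((z.1.1, z.2.1), (z.1.2, z.2.2))).
    by move=> [[? ?] [? ?]].
  by move=> [[? ?] [? ?]].
have en : \sum_c \sum_s energy (a c s) (b c s) <=
    \sum_c energy (Gc c.1 c.2) (Pc c.1 c.2) + xi ^+ 2.
  by rewrite -EnE (le_trans (max _ _ _ _ mf' mg'))// /En pair_bigA.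
have a0 c s : 0 <= a c s by exact: G0.
have b0 c s : 0 <= b c s by rewrite mulr_ge0.
have := energy_defect a0 b0 xi0 (ltW L0) aE bE tot en => good_le.
have GBE : G B E = \sum_i \sum_j a (i, j) (true, true).
  rewrite (partition_total (GDl mE) mf)//; apply: eq_bigr => i _.
  rewrite (partition_total (GDr (measurableI _ _ mB (mf i))) mg)//.
  apply: eq_bigr => j _; rewrite /a !fibB/=.
  by congr G; rewrite setIC; congr (_ `&` _); apply/seteqP; split => x /=;
    [move=> /mem_set|move=> /set_mem|move=> /mem_set|move=> /set_mem].
have PBE i j : phi (B `&` f @^-1` [set i]) * phi (E `&` g @^-1` [set j])
    = b (i, j) (true, true).
  rewrite /b !fibB/=.
  by congr (phi _ * phi _); rewrite setIC; congr (_ `&` _); apply/seteqP; split => x /=;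
    [move=> /mem_set|move=> /set_mem|move=> /mem_set|move=> /set_mem].
rewrite GBE pair_bigA [X in _ - X]pair_bigA/= -sumrB.
apply: (le_trans (ler_norm_sum _ _ _)).
rewrite (bigID (fun c : I * J => good c.1 c.2))/=.
have -> : 3 * eta = eta + (eta + eta) by ring.
apply: lerD.
  apply: (@le_trans _ _ ((1 + L) * (3 * xi))); last first.
    by rewrite /xi le_eqVlt; apply/orP; left; apply/eqP; field; rewrite gt_eqF.
  apply: le_trans good_le; apply: ler_sum => -[i j] /= gd.
  rewrite gd PBE (bigD1 (true, true))//= ler_wpDr ?sumr_ge0//.
apply: le_trans bad_le; rewrite pair_big_dep/=; apply: ler_sum => -[i j] /= /negbTE ->.
rewrite mul0r subr0 ger0_norm// bimeasure_mono//.
- by move=> x /= [].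
- by move=> x /= [].
Qed.

End bimeasure_regularity.

(** * Quasicompactness *)

Section finite_rank.
Context {d : measure_display} {X : measurableType d} {R : realType}.
Implicit Types (mu nu : ba X R) (E C : set X).

Definition restrict_fun mu C E : R := if `[< measurable E >] then mu (E `&` C) else 0.

Fact restrict_ba mu C : measurable C -> restrict_fun mu C \in @ba_pred d X R.
Proof.
move=> mC; rewrite inE; split.
- move=> A B mA mB AB /=; rewrite -EFinD; congr EFin.
  rewrite /restrict_fun !asboolT//; last exact: measurableU.
  rewrite setIUl ba_add//; [exact: measurableI..|].
  by rewrite setIACA AB set0I.
- have [M M0 muM] := ba_bounded mu; exists M => E mE.
  by rewrite /restrict_fun asboolT.
- by move=> E nE; rewrite /restrict_fun asboolF.
Qed.

Fact restrict_ca mu C (mC : measurable C) : is_ca mu -> is_ca (Ba (restrict_ba mu mC)).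
Proof.
move=> /is_caP ca; apply/is_caP => F mF tF /=.
rewrite /restrict_fun asboolT; last exact: bigcup_measurable.
rewrite setI_bigcupl (_ : (fun _ => _) = fun n => \sum_(0 <= i < n) mu (F i `&` C)).
  apply: ca; first by move=> i; exact: measurableI.
  exact: trivIset_setIr.
by apply/funext => n; apply: eq_bigr => i _; rewrite asboolT.
Qed.

Lemma ca_sum_scaleE (J : finType) (c : J -> R) (psi : J -> ca X R) :
  ca_ba (\sum_j c j *: psi j) = \sum_j c j *: ca_ba (psi j).
Proof.
elim: (index_enum J) => [|j r IH]; first by rewrite !big_nil.
by rewrite !big_cons -IH.
Qed.

(** On the unit ball the coefficients stay in a compact box, and [S] maps this box continuously onto
    a compact set. *)
Lemma finite_rank_compact (J : finType) (u : J -> X -> R) (psi : J -> ca X R) :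
  (forall j, bmf (u j)) -> exists A1 : {linear ca X R -> ca X R},
    compact_operator A1 /\
    forall nu : ca X R, A1 nu = \sum_j ba_int (ca_ba nu) (u j) *: psi j.
Proof.
move=> bu; pose T (nu : ca X R) : ca X R := \sum_j ba_int (ca_ba nu) (u j) *: psi j.
have linT : linear T.
  move=> a nu1 nu2; rewrite /T scaler_sumr -big_split/=; apply: eq_bigr => j _.
  by rewrite scalerA -scalerDl -ba_int_linear.
pose A1 : {linear ca X R -> ca X R} := HB.pack T (GRing.isLinear.Build _ _ _ _ T linT).
exists A1; split => //.
have /choice[M MP] : forall j, exists M : R, 0 <= M /\ forall x, `|u j x| <= M.
  by move=> j; have [M] := bmf_bound (bu j); exists M.
pose S (v : 'rV[R]_#|J|) : ca X R := \sum_j v ord0 (enum_rank j) *: psi j.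
pose seg (i : 'I_#|J|) := `[- M (enum_val i), M (enum_val i)]%classic.
pose box := [set v : 'rV[R]_#|J| | forall i, seg i (v ord0 i)].
have cbox : compact box.
  by apply: (@rV_compact _ _ seg) => i; exact: segment_compact.
have cS : continuous S.
  move=> v; rewrite /S.
  apply: (@cvg_big _ _ +%R 0 xpredT (@add_continuous _)) => [|j _].
    exact: nbhs_filter.
  by apply: cvgZr_tmp; [exact: nbhs_filter|exact: coord_continuous].
apply: (@precompact_subset _ _ (S @` box)).
  move=> _ [nu /= nu1 <-]; exists (\row_i ba_int (ca_ba nu) (u (enum_val i))).
    move=> i; rewrite /seg/= mxE in_itv/= -ler_norml.
    have [M0 uM] := MP (enum_val i).
    by rewrite (le_trans (ba_int_le_norm (ca_ba nu) (bu _) M0 uM))// ler_piMr.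
  by rewrite /S /T; apply: eq_bigr => j _; rewrite mxE enum_rankK.
apply: compact_precompact; first exact: norm_hausdorff.
by apply: continuous_compact => //; exact: continuous_subspaceT.
Qed.

End finite_rank.

Section quasicompactness.
Context {d : measure_display} {X : measurableType d} {R : realType}.
Variable p : R.-pker X ~> X.
Implicit Types (f g : X -> R) (E : set X) (mu nu : ba X R).
Variables (phi : ba X R) (C : R).
Hypotheses (Dphi : Delta_ba p phi) (caphi : is_ca phi)
  (phiC : forall nu, Delta_ba p nu -> forall E, measurable E ->
    nu E <= C * phi E).

Let phi0 : 0 <= phi. Proof. exact: Dphi.1.1. Qed.

Let G m (B E : set X) := ba_int phi (fun x => \1_B x * transn p m \1_E x).

Let bG m (B E : set X) : measurable B -> measurable E ->
  bmf (fun x => \1_B x * transn p m \1_E x).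
Proof. by move=> mB mE; apply: bmfM; [|apply: bmf_transn]; exact: bmf_indic. Qed.

Let GDl m E : measurable E -> additive_on (G m ^~ E).
Proof.
move=> mE A B mA mB AB; rewrite /G -ba_intD; [|exact: bG..].
by congr ba_int; apply/funext => x; rewrite indicU_disj// mulrDl.
Qed.

Let GDr m B : measurable B -> additive_on (G m B).
Proof.
move=> mB E F mE mF EF; rewrite /G -ba_intD; [|exact: bG..].
by congr ba_int; apply/funext => x; rewrite transn_indicU// mulrDr.
Qed.

Let G0 m B E : measurable B -> measurable E -> 0 <= G m B E.
Proof.
move=> mB mE; apply: ba_int_ge0 => //; first exact: bG.
by move=> x; rewrite mulr_ge0 ?transn_indic_ge0// indicE.
Qed.

Let GT m B : measurable B -> G m B setT = phi B.
Proof.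
move=> mB; rewrite /G -ba_int_indic//; congr ba_int; apply/funext => x.
rewrite (_ : \1_setT = fun=> 1) ?transn_cst ?mulr1//.
by apply/funext => y; rewrite indicT.
Qed.

Let G_small m B E (eta : R) : measurable B -> measurable E ->
  (forall x, transn p m \1_E x <= eta) -> G m B E <= eta * phi B.
Proof.
move=> mB mE h; rewrite -ba_int_indicZ//; apply: ba_int_mono => //.
- exact: bG.
- exact/bmfZ/bmf_indic.
- by move=> x; rewrite mulrC ler_wpM2r// indicE.
Qed.

Lemma indic_fibre (I : finType) (f : X -> I) (c : I -> R) x :
  \sum_i c i * \1_(f @^-1` [set i]) x = c (f x).
Proof.
rewrite (bigD1 (f x))//= indicE mem_set// mulr1 big1 ?addr0// => i ifx.
by rewrite indicE memNset ?mulr0//= => fxi; move: ifx; rewrite -fxi eqxx.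
Qed.

(* The cut norm controls the L1(phi) norm of x |-> p^m(x, E) - Q(x, E), with Q
   the step kernel, since the set where this function is positive is an
   admissible first argument. *)
Lemma step_kernel_approx m (eta : R) (I J : finType) (f : X -> I) (g : X -> J)
    (r : I -> J -> R) E : measurable_fibres f -> measurable_fibres g ->
  measurable E ->
  (forall B E, measurable B -> measurable E ->
      `|G m B E - \sum_i \sum_j r i j *
         (phi (B `&` f @^-1` [set i]) * phi (E `&` g @^-1` [set j]))|
      <= eta) ->
  ba_int phi (fun x => `|transn p m \1_E x -
    \sum_i (\sum_j r i j * phi (E `&` g @^-1` [set j])) * \1_(f @^-1` [set i]) x|)
  <= eta + eta.
Proof.
move=> mf mg mE cut.
pose Q x :=
  \sum_i (\sum_j r i j * phi (E `&` g @^-1` [set j])) * \1_(f @^-1` [set i]) x.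
pose h x := transn p m \1_E x - Q x.
have bQ : bmf Q by apply: bmf_sum => i; exact/bmfZ/bmf_indic.
have bT : bmf (transn p m \1_E) by exact/bmf_transn/bmf_indic.
have bh : bmf h by exact: bmfB.
have hB B : measurable B -> `|ba_int phi (fun x => \1_B x * h x)| <= eta.
  move=> mB; have := cut B E mB mE; congr (`|_| <= _).
  have b1 : bmf (fun x => \1_B x * Q x) by apply: bmfM => //; exact: bmf_indic.
  rewrite (_ : (fun x => \1_B x * h x) =
      fun x => \1_B x * transn p m \1_E x - \1_B x * Q x).
    rewrite ba_intB//; last exact: bG.
    congr (_ - _); symmetry.
    rewrite (_ : (fun x => _) = fun x => \sum_i
      (\sum_j r i j * phi (E `&` g @^-1` [set j])) * \1_(B `&` f @^-1` [set i]) x).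
      rewrite ba_int_sum; last by move=> i; apply/bmfZ/bmf_indic; exact: measurableI.
      apply: eq_bigr => i _; rewrite ba_int_indicZ; last exact: measurableI.
      rewrite mulr_suml; apply: eq_bigr => j _.
      by rewrite -mulrA [in RHS](mulrC (phi _)).
    apply/funext => x; rewrite /Q mulr_sumr; apply: eq_bigr => i _.
    by rewrite indicI/= mulrCA.
  by apply/funext => x; rewrite -mulrBr.
have mP : measurable [set x | 0 < h x] by exact: bmf_gt_measurable.
have mN : measurable (~` [set x | 0 < h x]) by exact: measurableC.
have b1 B : measurable B -> bmf (fun x => \1_B x * h x).
  by move=> mB; apply: bmfM => //; exact: bmf_indic.
(* |h| is [h] on the set where it is positive minus [h] on the complement, and the cut bound applies
   to each. *)
rewrite (_ : (fun x => _) = fun x => \1_[set x | 0 < h x] x * h x -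
    \1_(~` [set x | 0 < h x]) x * h x).
  rewrite ba_intB; [|exact: b1..].
  have := hB _ mP; have := hB _ mN; rewrite !ler_norml => /andP[a1 _] /andP[_ a2].
  by rewrite lerD// lerNl.
apply/funext => x; rewrite -[X in `|X|]/(h x) !indicE.
have [hx|hx] := ltP 0 (h x).
  by rewrite mem_set// memNset ?mul1r ?mul0r ?subr0 ?gtr0_norm//=; exact.
rewrite memNset ?mem_set ?mul0r ?mul1r ?sub0r ?ler0_norm//= => [|/lt_geF].
  by apply/negP; rewrite -leNgt.
by rewrite hx.
Qed.

Lemma quasicompact : condition_K p.
Proof.
(* The final norm bound is 2 (t + t) = 1/2. *)
pose t : R := 1 / 8; have t0 : 0 < t by rewrite divr_gt0.
have [m1 [delta1 [m10 delta10 H1]]] := transn_uniform_small Dphi caphi phiC t0.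
(* The cut error 3 eta becomes an L1 error 6 eta, and Markov's inequality at level [t] leaves a set
   of measure at most 6 eta / t = delta1. *)
pose eta := t * delta1 / 6.
have eta0 : 0 < eta by rewrite divr_gt0// mulr_gt0.
have [m2 [delta2 [m20 delta20 H2]]] := transn_uniform_small Dphi caphi phiC eta0.
have [I [J [f [g [r [mf mg r0 r1 cut]]]]]] := bimeasure_regularity Dphi.1
  (@GDl m2) (@GDr m2) (@G0 m2) (@GT m2) eta0 delta20
  (fun B E mB mE phiE => G_small mB mE (H2 E mE phiE)).
pose c i E := \sum_j r i j * phi (E `&` g @^-1` [set j]).
pose Q E x := \sum_i c i E * \1_(f @^-1` [set i]) x.
have bQ E : bmf (Q E) by apply: bmf_sum => i; exact/bmfZ/bmf_indic.
have c0 i E : 0 <= c i E by apply: sumr_ge0 => j _; rewrite mulr_ge0// ba_nneg.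
have c1 i E : measurable E -> c i E <= 1.
  move=> mE; apply: le_trans (r1 i); apply: ler_sum => j _; rewrite ler_wpM2l//.
  by apply: ba_mono => //; exact: measurableI.
(* [A1] is A^m1 followed by the step kernel: [psi j] is phi restricted to the [j]-th column, and
   [u j] applies T^m1 to the weights of that column. *)
pose psi j : ca X R := Ca (mem_set (restrict_ca (mC := mg j) caphi)).
pose u j x := \sum_i r i j * transn p m1 \1_(f @^-1` [set i]) x.
have bT1 i : bmf (transn p m1 \1_(f @^-1` [set i])) by exact/bmf_transn/bmf_indic.
have bu j : bmf (u j) by apply: bmf_sum => i; exact: bmfZ.
have [A1 [cA1 A1E]] := finite_rank_compact psi bu.
exists A1, (m1 + m2)%N; split => //; first by rewrite addn_gt0 m10.
have A1Q (nu : ca X R) E : measurable E ->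
    ca_ba (A1 nu) E = ba_int (ca_ba nu) (transn p m1 (Q E)).
  move=> mE; rewrite A1E ca_sum_scaleE ba_sum_scaleE transn_sum; last first.
    by move=> i; exact/bmfZ/bmf_indic.
  rewrite ba_int_sum; last by move=> i; exact/bmf_transn/bmfZ/bmf_indic.
  rewrite (eq_bigr (fun j => \sum_i r i j * phi (E `&` g @^-1` [set j]) *
      ba_int (ca_ba nu) (transn p m1 \1_(f @^-1` [set i])))); last first.
    move=> j _; rewrite ba_int_sum; last by move=> i; exact: bmfZ.
    rewrite mulr_suml; apply: eq_bigr => i _; rewrite ba_intZ//.
    by rewrite /psi/= /restrict_fun asboolT// mulrAC.
  rewrite exchange_big; apply: eq_bigr => i _; rewrite transnZ; last exact: bmf_indic.
  by rewrite ba_intZ// /c mulr_suml.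
have hE E x : measurable E ->
    `|transn p m1 (fun y => transn p m2 \1_E y - Q E y) x| <= t + t.
  move=> mE; pose h y := transn p m2 \1_E y - Q E y.
  have bh : bmf h by apply: bmfB => //; exact/bmf_transn/bmf_indic.
  have bnh : bmf (fun y => `|h y|) by exact: bmf_norm.
  have h1 y : `|h y| <= 1.
    rewrite /h /Q indic_fibre; have := transn_indic_ge0 p m2 y mE.
    have := transn_indic_le1 p m2 y mE; have := c0 (f y) E; have := c1 (f y) E mE.
    by move=> *; rewrite ler_norml; apply/andP; split; lra.
  pose D := [set y | t < `|h y|].
  have mD : measurable D by exact: bmf_gt_measurable.
  have phiD : phi D <= delta1.
    have := ba_markov phi0 bnh (fun y => normr_ge0 _) mD.
    have := step_kernel_approx mf mg mE cut; rewrite -/(Q E) => a1 a2.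
    have := le_trans a2 a1; rewrite -ler_pdivlMl// => /le_trans; apply.
    rewrite le_eqVlt; apply/orP; left; apply/eqP.
    by rewrite /eta; field; rewrite gt_eqF.
  have bD : bmf (fun y => \1_D y + t) by apply: bmfD; [exact: bmf_indic|exact: bmf_cst].
  (* Off [D] the error is at most [t], and T^m1 of the indicator of [D] is at most [t] since phi(D)
     <= delta1. *)
  have hD y : `|h y| <= \1_D y + t.
    rewrite indicE; have [lt|le] := ltP t `|h y|.
      by rewrite mem_set// (le_trans (h1 y))// lerDl ltW.
    by rewrite (le_trans le)// lerDr.
  have up y : transn p m1 (fun y => `|h y|) y <= t + t.
    rewrite (le_trans (transn_mono p m1 bnh bD hD y))//.
    rewrite transnD ?transn_cst; [|exact: bmf_indic|exact: bmf_cst].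
    by rewrite lerD2r H1.
  rewrite -/h ler_norml; apply/andP; split.
    rewrite lerNl (le_trans _ (up x))//.
    have := transn_mono p m1 (bmfN bh) bnh _ x; rewrite transnN//; apply.
    by move=> y; rewrite -normrN ler_norm.
  by rewrite (le_trans _ (up x))//; apply: transn_mono => // y; exact: ler_norm.
apply: (@le_lt_trans _ _ (1 / 2)%:E); last by rewrite lte_fin; lra.
apply: ge_ereal_sup => _ [nu /= nu1 <-]; rewrite lee_fin.
have -> : 1 / 2 = (t + t) + (t + t) :> R by rewrite /t; lra.
apply: norm_le_twice => E mE.
have -> : (iter (m1 + m2) (markov_op p) nu - ca_ba (A1 nu)) E =
    ba_int (ca_ba nu) (transn p m1 (fun y => transn p m2 \1_E y - Q E y)).
  rewrite -[LHS]/(iter (m1 + m2) (markov_op p) nu E - ca_ba (A1 nu) E).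
  rewrite iter_markovE// A1Q// -ba_intB.
  - by rewrite transn_add -transnB//; exact/bmf_transn/bmf_indic.
  - exact/bmf_transn/bmf_indic.
  - exact/bmf_transn.
have tt0 : 0 <= t + t by rewrite addr_ge0// ltW.
apply: (le_trans (ba_int_le_norm _ _ tt0 (fun x => hE E x mE))).
  by apply/bmf_transn/bmfB => //; exact/bmf_transn/bmf_indic.
by rewrite ler_piMr.
Qed.

End quasicompactness.

(** * The dominating invariant measure and the conclusion *)

Lemma ba_int_sum_scale (d : measure_display) (X : measurableType d) (R : realType)
    (I : Type) (r : seq I) (c : I -> R) (H : I -> ba X R) (f : X -> R) : bmf f ->
  ba_int (\sum_(i <- r) c i *: H i) f = \sum_(i <- r) c i * ba_int (H i) f.
Proof.
move=> bf; elim: r => [|i r IH]; last by rewrite !big_cons ba_int_linear// IH.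
rewrite !big_nil; have [M M0 fM] := bmf_bound bf.
apply/eqP; rewrite -normr_le0; have := ba_int_le_norm 0 bf M0 fM.
by rewrite normr0 mulr0.
Qed.

(** The measure is the mean of the [H i]: since nu is the sum of the nu(K_i) H_i with nu(K_i) <= 1,
    it is at most the sum of the H_i. *)
Lemma dominating_invariant_measure (d : measure_display) (X : measurableType d)
    (R : realType) (p : R.-pker X ~> X) (n : nat) (H : 'I_n -> ba X R) :
  [set: X] !=set0 -> disjoint_basis p H -> condition_alpha p ->
  condition_beta H -> exists phi : ba X R,
  [/\ Delta_ba p phi, is_ca phi & forall nu, Delta_ba p nu ->
      forall E, measurable E -> nu E <= n%:R * phi E].
Proof.
move=> [x _] dH alpha beta; have [HM DH _] := dH.
have [K KP] := singular_closed_supports dH alpha beta.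
have caH := singular_basis_ca dH alpha beta.
have nuE nu : Delta_ba p nu -> nu = \sum_(j < n) nu (K j) *: H j.
  move=> Dnu; apply: invariant_decomposition Dnu.2 => // [j|j k].
    by have [] := KP j.
  by have [_ _ + _] := KP j; apply.
(* An empty basis would make every invariant probability 0, whereas an ultralimit started at [x] has
   norm 1. *)
have n0 : (0 < n)%N.
  rewrite lt0n; apply/eqP => n0; move: H K HM DH dH KP caH nuE beta; rewrite n0.
  move=> H K _ _ _ _ _ nuE _.
  have [//|U [nu [_ _ Dnu _]]] := @ultralimit _ _ _ p (fun=> x) S.
  have := Dnu.1.2; rewrite (nuE _ Dnu) big_ord0 normr0 => /eqP.
  by rewrite eq_sym oner_eq0.
have nR0 : n%:R != 0 :> R by rewrite pnatr_eq0 -lt0n.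
pose phi := \sum_(i < n) n%:R^-1 *: H i.
have phiE E : phi E = n%:R^-1 * \sum_(i < n) H i E.
  by rewrite /phi ba_sum_scaleE mulr_sumr.
have H0 i E : 0 <= H i E by apply: ba_nneg; exact: (DH i).1.1.
have phi0 : 0 <= phi.
  by apply/ba_ge0P => E _; rewrite phiE mulr_ge0 ?invr_ge0// sumr_ge0.
exists phi; split.
- split; last first.
    apply: ba_ext => E mE; rewrite markov_opE// ba_int_sum_scale; last first.
      exact/bmf_trans/bmf_indic.
    rewrite ba_sum_scaleE; apply: eq_bigr => i _; congr (_ * _).
    by rewrite -markov_opE// (DH i).2.
  split => //; rewrite nneg_norm// phiE (eq_bigr (fun=> 1)).
    by rewrite sumr_const card_ord mulVf.
  by move=> i _; exact: S_baT (DH i).1.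
- exact: is_ca_sum.
- move=> nu Dnu E mE; rewrite phiE mulrA mulfV// mul1r.
  rewrite [X in ba_fun X](nuE _ Dnu) ba_sum_scaleE; apply: ler_sum => i _.
  have [mK _ _ _] := KP i.
  by rewrite ler_piMl// S_ba_le1//; exact: Dnu.1.
Qed.

Theorem theorem5p5 (R : realType) (d : measure_display) (X : measurableType d)
    (X_infinite : infinite_set [set: X])
    (X_points : forall x : X, measurable [set x])
    (p : R.-pker X ~> X)
    (n : nat) (dim_M : has_dim (M_ba p) n)
    (alpha : condition_alpha p)
    (H : 'I_n -> ba X R) (H_basis : disjoint_basis p H)
    (beta : condition_beta H) :
  [/\ condition_star p, condition_D p, condition_Dtilde p & condition_K p].
Proof.
have X0 : [set: X] !=set0.
  by apply/set0P/eqP => XE; apply: X_infinite; rewrite XE; exact: finite_set0.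
have [phi [Dphi caphi phiC]] := dominating_invariant_measure X0 H_basis alpha beta.
split.
- move=> mu Dmu; have [[_ _ HM] _ _] := H_basis.
  have [c ->] := HM _ Dmu.2.
  exact/is_ca_sum/(singular_basis_ca H_basis alpha beta).
- exact: Doeblin_condition Dphi caphi phiC.
- exact: averaged_Doeblin_condition Dphi caphi phiC.
- exact: quasicompact Dphi caphi phiC.
Qed.
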